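(* Let $H$ be a separable Hilbert space, let $X$ be an $H$-valued random variable satisfying assumptions (A1) and (A2) given in the context, and let $m$ be its geometric median. Let $\alpha\in(1/2,1)$, $c_\gamma>0$, $\gamma_n=c_\gamma n^{-\alpha}$, let $(Z_n)_{n\ge 1}$ be the stochastic gradient sequence $$Z_{n+1}=Z_n+\gamma_n\frac{X_{n+1}-Z_n}{\|X_{n+1}-Z_n\|},\qquad n\ge 1,$$ where $X_1,X_2,\dots$ are independent copies of $X$ and $Z_1$ is bounded, and let $\overline{Z}_n=\frac1n\sum_{k=1}^n Z_k$ be its averaged version. Then for all $\delta>0$, $$\|\overline{Z}_n-m\|=o\left(\frac{(\ln n)^{\frac{1+\delta}{2}}}{\sqrt{n}}\right)\quad\text{almost surely, as } n\to\infty.$$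
   Context: $H$ is a separable Hilbert space (possibly infinite dimensional) with inner product $\langle\cdot,\cdot\rangle$ and norm $\|\cdot\|$. The geometric median of $X$ is $m:=\arg\min_{h\in H}\mathbb{E}[\|X-h\|-\|X\|]$. No moment assumption is made on $X$. Assumptions: (A1) For all $h\in H$ there is $h'\in H$ such that $\langle h,h'\rangle=0$ and $\mathrm{Var}(\langle X,h'\rangle)>0$. (This ensures that $m$ is uniquely defined.) (A2) There is a positive constant $C$ such that for all $h\in H$, $\mathbb{E}[1/\|X-h\|]\le C$ and $\mathbb{E}[1/\|X-h\|^2]\le C$. $X_1,X_2,\dots$ are independent random variables with the same law as $X$. The initialization $Z_1$ is bounded (for instance $Z_1=X_1\mathbf 1_{\{\|X_1\|\le M\}}$ with $M$ a constant) or deterministic; it is measurable with respect to $\sigma(X_1)$. The event $X_{n+1}=Z_n$ has probability zero under (A2). *)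

(* Defs.v *)
From HB Require Import structures.
From mathcomp Require Import all_boot all_order all_algebra.
From mathcomp Require Import sesquilinear finmap.
From mathcomp Require Import all_classical all_reals all_analysis.

Set Implicit Arguments.
Unset Strict Implicit.
Unset Printing Implicit Defensive.

Import Order.TTheory GRing.Theory Num.Theory.
Import numFieldNormedType.Exports.

Local Open Scope classical_set_scope.
Local Open Scope ring_scope.

(* A real Hilbert space is a complete normed module [H] over [R : realType]
   together with an inner product [dot : {dot H for idfun}] inducing its norm. *)
Definition induces_norm (R : realType) (H : normedModType R)
    (dot : {dot H for idfun}) : Prop :=
  forall x : H, dot x x = `|x| ^+ 2.

Definition separable (H : topologicalType) : Prop :=
  exists2 D : set H, countable D & dense D.

(* [H] itself, equipped with its Borel sigma-algebra *)
Notation borel H := (g_sigma_algebraType (@open H)).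

Section geometric_median.
Local Open Scope ereal_scope.
Context d (T : measurableType d) (R : realType) (P : probability T R).
Variable H : completeNormedModType R.

Definition geometric_median (X : T -> H) (m : H) : Prop :=
  forall h : H, 'E_P[fun w => (`|X w - m| - `|X w|)%R]
             <= 'E_P[fun w => (`|X w - h| - `|X w|)%R].

(* No moment of [X] is assumed. [variance] centers at [fine 'E_P[_]], a real
   number even when the mean does not exist, in which case the variance is
   +oo. *)
Definition assumption_A1 (dot : {dot H for idfun}) (X : T -> H) : Prop :=
  forall h : H, exists h' : H,
    dot h h' = 0%R /\ 0 < variance P (fun w => dot (X w) h').

(* The inverse is that of [\bar R], with 0^-1 = +oo. In [R], 0^-1 = 0, which
   would hide an atom of [X] at [h]. *)
Definition assumption_A2 (X : T -> H) : Prop :=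
  exists2 C : R, (0 < C)%R & forall h : H,
    \int[P]_w (`|X w - h|%:E)^-1 <= C%:E /\
    \int[P]_w ((`|X w - h| ^+ 2)%:E)^-1 <= C%:E.

End geometric_median.

Section families_of_random_variables.
Local Open Scope ereal_scope.
Context d d' (T : measurableType d) (T' : measurableType d').
Context (R : realType) (P : probability T R).

(* A measure is a total function on [set T'], with no meaning outside the
   measurable sets, so laws are only compared on the latter. *)
Definition same_law (X Y : {RV P >-> T'}) : Prop :=
  forall A : set T', measurable A -> distribution P X A = distribution P Y A.

Definition mutually_independent (I : choiceType) (D : set I)
    (X : I -> {RV P >-> T'}) : Prop :=
  forall (J : {fset I}) (B : I -> set T'),
    [set` J] `<=` D -> (forall i, i \in J -> measurable (B i)) ->
    P (\bigcap_(i in [set` J]) (X i @^-1` B i)) =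
    \prod_(i <- J) P (X i @^-1` B i).

End families_of_random_variables.

Section averaged_stochastic_gradient.
Context (T : Type) (R : realType) (H : normedModType R).

(* Indices start at 1; the terms of index 0 play no role. When
   [X n.+1 w = Z n w] the increment is 0. *)
Definition stochastic_gradient (c alpha : R) (X Z : nat -> T -> H) : Prop :=
  forall (n : nat) (w : T), (1 <= n)%N ->
    Z n.+1 w = Z n w +
      (c * n%:R `^ (- alpha)) *:
        (`|X n.+1 w - Z n w|^-1 *: (X n.+1 w - Z n w)).

Definition average (Z : nat -> T -> H) (n : nat) (w : T) : H :=
  n%:R^-1 *: \sum_(1 <= k < n.+1) Z k w.

End averaged_stochastic_gradient.

(* Main.v *)
Require Import Defs.
From HB Require Import structures.
From mathcomp Require Import all_boot all_order all_algebra.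
From mathcomp Require Import sesquilinear finmap ring lra.
From mathcomp Require Import all_classical all_reals all_analysis.
From mathcomp Require Import measurable_realfun.

Set Implicit Arguments.
Unset Strict Implicit.
Unset Printing Implicit Defensive.

Import Order.TTheory GRing.Theory Num.Theory.
Import numFieldNormedType.Exports.

Local Open Scope classical_set_scope.
Local Open Scope ring_scope.

(* Write T_n = Z_n - m and let Phi h = - E[(X - h) / |X - h|] be the gradient of
   the objective, so that Z_(n+1) = Z_n - gamma_n (Phi (Z_n) - xi_(n+1)) with
   martingale increments xi bounded by 2.
   Gradient: (A2) makes Phi Lipschitz, Phi m = 0 by convexity, and
   Phi (m + h) is, up to O(|h|^2), linear in h. The curvature
   E[sin^2(X - m, u) / (1 + |X - m|)] is bounded below over unit vectors u: the
   sine is a distance on lines, so averaging the triangle inequality over two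
   independent copies of X bounds it by a constant that (A1) makes positive.
   Hence lam |mean T_k| <= |mean Phi (Z_k)| + K mean |T_k|^2.
   Almost sure rates: a single maximal inequality for nonnegative
   supermartingales, applied to V_n + (tail of a summable series), gives that T_n
   is bounded, and then, after truncation at a bound of |T_k|,
   |T_n|^2 = o(n^(1 - 2 alpha) (ln n)^(1 + delta)),
   |sum xi_k|^2 = o(n (ln n)^(1 + delta)), and, since E |T_n|^2 = O(n^-alpha) with
   alpha > 1/2, that sum |T_k|^2 and sum k^(alpha - 1) |T_k| are o(sqrt n).
   Summation by parts of (Z_(k+1) - Z_k) / gamma_k bounds sum Phi (Z_k) by these
   quantities. *)

(** * Geometry of the inner product *)

(** The gradient has norm at most 1, so relative to the squared error the pull towards [m] weakens
    like 1 / (1 + |h - m|). A contraction with a fixed constant is available only while the errors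
    have stayed below some [M]. That event belongs to the past, so restricting to it keeps the noise
    orthogonal, and almost every path lies in it for some integer [M]. Conditional expectations
    appear as integrals against indicators of past events. Summable perturbations are carried by
    explicit potentials [B n]: multiples of n^(1 - 2 alpha) for the squared steps, and of (ln n)^(-
    delta) for the series of 1 / (n (ln n)^(1 + delta)), whose convergence is the origin of [delta].
    The Hessian at [m] is never inverted: the averaged linearisation is paired with the average
    itself, and coercivity does the rest. The almost sure rate of T_n is weaker than its mean square
    size, but it is exactly what the boundary term n^alpha T_n of the summation by parts must
    satisfy. *)

Definition direction (R : realType) (H : normedModType R) (x : H) : H :=
  `|x|^-1 *: x.

Section inner_product.
Context (R : realType) (H : normedModType R) (dot : {dot H for idfun}).
Hypothesis dot_norm : induces_norm dot.
Implicit Types x y u v h s : H.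

Lemma dotC u v : dot u v = dot v u.
Proof. by rewrite hermC /= expr0 mul1r. Qed.

Lemma dotDl u v x : dot (u + v) x = dot u x + dot v x.
Proof. exact: linearDl. Qed.

Lemma dotDr x u v : dot x (u + v) = dot x u + dot x v.
Proof. exact: linearDr. Qed.

Lemma dotBl u v x : dot (u - v) x = dot u x - dot v x.
Proof. exact: linearBl. Qed.

Lemma dotBr x u v : dot x (u - v) = dot x u - dot x v.
Proof. exact: linearBr. Qed.

Lemma dotNl x u : dot (- x) u = - dot x u.
Proof. exact: linearNl. Qed.

Lemma dot0l x : dot 0 x = 0.
Proof. exact: linear0l. Qed.

Lemma dot0r x : dot x 0 = 0.
Proof. exact: linear0r. Qed.

Lemma dotZl a u x : dot (a *: u) x = a * dot u x.
Proof. exact: linearZl_LR. Qed.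

Lemma dotZr a x u : dot x (a *: u) = a * dot x u.
Proof. by rewrite dotC dotZl dotC. Qed.

Lemma dot_suml I (r : seq I) (F : I -> H) x :
  dot (\sum_(i <- r) F i) x = \sum_(i <- r) dot (F i) x.
Proof. exact: linear_sumlz. Qed.

Lemma normDsq x y : `|x + y| ^+ 2 = `|x| ^+ 2 + 2 * dot x y + `|y| ^+ 2.
Proof. by rewrite -!dot_norm dotDl !dotDr (dotC y x); ring. Qed.

Lemma normBsq x y : `|x - y| ^+ 2 = `|x| ^+ 2 - 2 * dot x y + `|y| ^+ 2.
Proof. by rewrite -!dot_norm dotBl !dotBr (dotC y x); ring. Qed.

Lemma dot_polar x y : dot x y = (`|x| ^+ 2 + `|y| ^+ 2 - `|x - y| ^+ 2) / 2.
Proof. by rewrite normBsq; field. Qed.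

Lemma dot_le x y : `|dot x y| <= `|x| * `|y|.
Proof.
have [->|y0] := eqVneq y 0; first by rewrite dot0r !normr0 mulr0.
have ny : 0 < `|y| by rewrite normr_gt0.
have H0 := sqr_ge0 `|(`|y| ^+ 2) *: x - (dot x y) *: y|.
rewrite normBsq dotZl dotZr !normrZ !exprMn in H0.
rewrite !real_normK ?num_real // in H0.
rewrite -(@ler_pXn2r _ 2) ?nnegrE ?mulr_ge0 // exprMn real_normK ?num_real //.
have y2 : 0 < `|y| ^+ 2 by rewrite exprn_gt0.
rewrite -(ler_pM2l y2) -subr_ge0.
by apply: le_trans H0 _; rewrite le_eqVlt; apply/orP; left; apply/eqP; ring.
Qed.

Lemma ler_dot x y a b : `|x| <= a -> `|y| <= b -> `|dot x y| <= a * b.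
Proof. by move=> xa yb; rewrite (le_trans (dot_le _ _)) // ler_pM. Qed.

Lemma direction0 : direction 0 = 0 :> H.
Proof. by rewrite /direction scaler0. Qed.

Lemma normZ_direction x : `|x| *: direction x = x.
Proof.
have [->|x0] := eqVneq x 0; first by rewrite direction0 scaler0.
by rewrite /direction scalerA divff ?scale1r ?normr_eq0.
Qed.

Lemma norm_direction x : x != 0 -> `|direction x| = 1.
Proof.
by move=> x0; rewrite normrZ normfV normr_id mulVf // normr_eq0.
Qed.

Lemma norm_direction_le1 x : `|direction x| <= 1.
Proof.
have [->|x0] := eqVneq x 0; first by rewrite direction0 normr0.
by rewrite norm_direction.
Qed.

(** A norm equal to 0 or 1, in the form that lets [sine_triangle] cover [direction 0] too. *)
Lemma norm_direction_sq x : `|direction x| ^+ 2 = `|direction x|.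
Proof.
have [->|x0] := eqVneq x 0; first by rewrite direction0 normr0 expr0n.
by rewrite norm_direction // expr1n.
Qed.

Lemma dot_direction x : dot (direction x) x = `|x|.
Proof.
have [->|x0] := eqVneq x 0; first by rewrite dot0r normr0.
by rewrite -{2}(normZ_direction x) dotZr dot_norm norm_direction // expr1n mulr1.
Qed.

(** Only one of the two norms is inverted, so integrating the bound calls for (A2) at a single
    point. *)
Lemma direction_lipschitz x y : x != 0 ->
  `|direction x - direction y| <= 2 * `|x - y| * `|x|^-1.
Proof.
move=> x0; have nx : 0 < `|x| by rewrite normr_gt0.
have E : `|x| *: (direction x - direction y) =
    (x - y) + (`|y| - `|x|) *: direction y.
  by rewrite scalerBr scalerBl !normZ_direction addrA subrK.
have D : `| `|y| - `|x| | <= `|x - y|.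
  by rewrite distrC; exact: ler_dist_dist.
rewrite ler_pdivlMr // mulrC -{1}(normr_id x) -normrZ E.
rewrite (le_trans (ler_normD _ _)) // normrZ mulr_natl mulr2n lerD2l.
by rewrite -[leRHS]mulr1 ler_pM // norm_direction_le1.
Qed.

(** [direction x] is a subgradient of the norm at [x], including at 0. *)
Lemma norm_convex x y : `|x| - `|y| <= dot (direction x) (x - y).
Proof.
rewrite dotBr dot_direction lerD2l lerN2 (le_trans (ler_norm _)) //.
by rewrite -[leRHS]mul1r ler_dot // norm_direction_le1.
Qed.

(** With a = |x|, b = |x - k| and p = <x, x - k>, the right side is (a + b) (a b - p) / (a b) and
    the numerator on the left is (a b - p) (a b + p) / a^2. Once the common factor a b - p >= 0 is
    removed, p <= a b and b <= a + |k| suffice. *)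
Lemma direction_monotone x k :
  (`|k| ^+ 2 - dot (direction x) k ^+ 2) / (2 * (`|x| + `|k|)) <=
  dot (direction x - direction (x - k)) k.
Proof.
have [->|k0] := eqVneq k 0.
  by rewrite !dot0r normr0 expr0n subrr mul0r.
have nk : 0 < `|k| by rewrite normr_gt0.
have den : 0 < 2 * (`|x| + `|k|) by rewrite mulr_gt0 // ltr_wpDl.
rewrite ler_pdivrMr //.
have [->|x0] := eqVneq x 0.
  have := dot_direction (- k); rewrite -{2}scaleN1r dotZr normrN.
  by rewrite direction0 !sub0r dotNl dot0l normr0; nra.
have nx : 0 < `|x| by rewrite normr_gt0.
have Ek : dot (direction x) k = dot x k / `|x|.
  by rewrite /direction dotZl mulrC.
set y := x - k; have Hk : k = x - y by rewrite /y opprB addrC subrK.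
have [y0|y0] := eqVneq y 0.
  have xk : x = k by apply/eqP; rewrite -subr_eq0 -/y y0.
  rewrite y0 direction0 subr0 -xk dot_direction subrr.
  by rewrite !mulr_ge0 // addr_ge0.
have ny : 0 < `|y| by rewrite normr_gt0.
have yk : `|y| <= `|x| + `|k| by rewrite /y ler_normB.
have Hp := dot_le x y; set p := dot x y in Hp.
have Dk : dot (direction x) k = (`|x| ^+ 2 - p) / `|x|.
  by rewrite Ek Hk dotBr dot_norm.
have -> : dot (direction x - direction y) k =
    (`|x| + `|y|) * (`|x| * `|y| - p) / (`|x| * `|y|).
  rewrite dotBl Dk /direction dotZl Hk dotBr dot_norm (dotC y) -/p.
  by field; rewrite !normr_eq0 x0 y0.
have -> : `|k| ^+ 2 - dot (direction x) k ^+ 2 =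
    (`|x| * `|y| - p) * (`|x| * `|y| + p) / `|x| ^+ 2.
  by rewrite Dk Hk normBsq -/p; field; rewrite normr_eq0.
have {Hp} /andP[p1 p2] : (- (`|x| * `|y|) <= p <= `|x| * `|y|).
  by rewrite -ler_norml.
clear Dk Ek; move: p1 p2 yk nx ny nk den; clearbody p.
move: (`|x|) (`|y|) (`|k|) => a b c p1 p2 bc a0 b0 c0 den.
rewrite ler_pdivrMr ?exprn_gt0 //.
have -> : (a + b) * (a * b - p) / (a * b) * (2 * (a + c)) * a ^+ 2 =
   (a * b - p) * ((a + b) * (2 * (a + c)) * a / b).
  by field; rewrite !gt_eqF.
apply: ler_wpM2l; first lra.
rewrite ler_pdivlMr //; nra.
Qed.

(** The main term is the Hessian of the norm at [x]. With y = x - h and directions s, v of x, y, the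
    remainder times |x| is (|y| - |x|) <v - s, u> + (|y| - |x| + <s, h>) <s, u>. The first product
    is quadratic in [h] by the Lipschitz bound; in the second, convexity puts the first factor
    between 0 and <s - v, h>. The resulting |x|^-2 is what the second bound of (A2) integrates. *)
Lemma direction_taylor x h u : x != 0 ->
  `|dot (direction x - direction (x - h)) u -
    (dot h u - dot (direction x) h * dot (direction x) u) / `|x| |
  <= 4 * `|h| ^+ 2 * `|u| * (`|x| ^- 2).
Proof.
move=> x0; have nx : 0 < `|x| by rewrite normr_gt0.
set y := x - h; set s := direction x; set v := direction y.
have xy : x - y = h by rewrite /y opprB addrC subrK.
have L : `|s - v| <= 2 * `|h| * `|x|^-1 by rewrite -xy direction_lipschitz.
have D1 : `| `|y| - `|x| | <= `|h|.
  by rewrite -xy distrC; exact: ler_dist_dist.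
have C1 : 0 <= `|y| - `|x| + dot s h.
  by have := norm_convex x y; rewrite xy -/s; lra.
have C2 : `|y| - `|x| + dot s h <= dot (s - v) h.
  have := norm_convex y x; rewrite -(opprB x y) xy -/v -[- h]scaleN1r dotZr.
  by rewrite dotBl; lra.
have C3 : dot (s - v) h <= 2 * `|h| * `|x|^-1 * `|h|.
  by rewrite (le_trans (ler_norm _)) // ler_dot.
have -> : dot (s - v) u - (dot h u - dot s h * dot s u) / `|x| =
   ((`|y| - `|x|) * dot (v - s) u + (`|y| - `|x| + dot s h) * dot s u) / `|x|.
  have E1 : dot s u = dot x u / `|x| by rewrite dotZl mulrC.
  have E2 : dot h u = dot x u - `|y| * dot v u.
    by rewrite -dotZl normZ_direction -dotBl xy.
  by rewrite !dotBl E2 E1; field; rewrite normr_eq0.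
rewrite normrM normfV normr_id ler_pdivrMr //.
have -> : 4 * `|h| ^+ 2 * `|u| * `|x| ^- 2 * `|x| =
  `|h| * (2 * `|h| * `|x|^-1 * `|u|) + 2 * `|h| * `|x|^-1 * `|h| * (1 * `|u|).
  by field; rewrite normr_eq0.
rewrite (le_trans (ler_normD _ _)) // !normrM lerD // ler_pM //.
- by rewrite -[v - s]opprB dotNl normrN ler_dot.
- by rewrite ger0_norm // (le_trans C2).
- by rewrite ler_dot // norm_direction_le1.
Qed.

(* [1 - dot s u ^+ 2] is the squared sine of the angle between the lines spanned
   by unit vectors [s] and [u]; the sine is a distance on lines. *)
Lemma sine_triangle s s' u : `|s| ^+ 2 = `|s| -> `|s'| ^+ 2 = `|s'| ->
  `|u| = 1 ->
  1 - dot s s' ^+ 2 <= 2 * (1 - dot s u ^+ 2) + 2 * (1 - dot s' u ^+ 2).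
Proof.
have sine_ge0 v w : `|v| <= 1 -> `|w| <= 1 -> 0 <= 1 - dot v w ^+ 2.
  move=> v1 w1; have := ler_dot v1 w1; rewrite mulr1 ler_norml => /andP[? ?].
  by nra.
have id01 v : `|v| ^+ 2 = `|v| -> v = 0 \/ `|v| = 1.
  move=> /eqP; rewrite -subr_eq0 -[X in _ - X]mulr1 expr2 -mulrBr mulf_eq0.
  by rewrite normr_eq0 subr_eq0 => /orP[/eqP|/eqP]; [left|right].
move=> /id01[->|s1] /id01[->|s1'] u1.
- by rewrite !dot0l; lra.
- have := @sine_ge0 s' u; rewrite !dot0l s1' u1 lexx => /(_ isT isT); nra.
- have := @sine_ge0 s u; rewrite !dot0l dot0r s1 u1 lexx => /(_ isT isT); nra.
have a1 := @sine_ge0 s u; rewrite s1 u1 lexx in a1; have {}a1 := a1 isT isT.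
have a2 := @sine_ge0 s' u; rewrite s1' u1 lexx in a2; have {}a2 := a2 isT isT.
set a := dot s u in a1 *; set b := dot s' u in a2 *; set c := dot s s'.
have P1 : `|s - a *: u| ^+ 2 = 1 - a ^+ 2.
  by rewrite normBsq dotZr normrZ exprMn real_normK ?num_real // s1 u1 -/a; ring.
have P2 : `|u - b *: s'| ^+ 2 = 1 - b ^+ 2.
  rewrite normBsq dotZr normrZ exprMn real_normK ?num_real // s1' u1 dotC -/b.
  by ring.
have P3 : `|s - (a * b) *: s'| ^+ 2 = 1 - 2 * (a * b) * c + (a * b) ^+ 2.
  rewrite normBsq dotZr normrZ exprMn real_normK ?num_real // s1 s1' -/c.
  by ring.
(* Project [s] on the line of [u], then on that of [s']. The squared distance from [s] to the result
   is 1 - c^2 + (a b - c)^2, hence at least the squared sine 1 - c^2. *)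
have P4 : `|s - (a * b) *: s'| <= `|s - a *: u| + `|a| * `|u - b *: s'|.
  rewrite -normrZ (le_trans _ (ler_normD _ _)) // scalerBr scalerA addrA.
  by rewrite subrK.
have P5 : `|s - (a * b) *: s'| ^+ 2 <=
    2 * `|s - a *: u| ^+ 2 + 2 * (a ^+ 2 * `|u - b *: s'| ^+ 2).
  rewrite -[a ^+ 2]real_normK ?num_real // -exprMn.
  move: P4 (normr_ge0 (s - (a * b) *: s')).
  move: (`|s - (a * b) *: s'|) (`|s - a *: u|) (`|a| * _) => p q r P4 p0.
  have : 0 <= (q - r) ^+ 2 by exact: sqr_ge0.
  nra.
rewrite P1 P2 P3 in P5.
have : 0 <= (a * b - c) ^+ 2 by exact: sqr_ge0.
nra.
Qed.

End inner_product.

(** * Riesz representation *)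

Section riesz.
Context (R : realType) (H : completeNormedModType R) (dot : {dot H for idfun}).
Hypothesis dot_norm : induces_norm dot.

(* The representing vector minimises [v |-> `|v| ^+ 2 - 2 * l v]: by the
   parallelogram law, minimising sequences are Cauchy. *)
Lemma riesz_representation (l : H -> R) (C : R) :
  (forall u v, l (u + v) = l u + l v) -> (forall a u, l (a *: u) = a * l u) ->
  (forall v, `|l v| <= C * `|v|) ->
  exists a : H, forall v, l v = dot a v.
Proof.
move=> lD lZ lC; pose J (v : H) : R := `|v| ^+ 2 - 2 * l v.
have J_ge v : - C ^+ 2 <= J v.
  have := lC v; rewrite ler_norml => /andP[_ ?].
  have := sqr_ge0 (`|v| - C); rewrite /J; nra.
have hasJ : has_inf (range J).
  split; first by exists (J 0), 0.
  by exists (- C ^+ 2) => _ [v _ <-].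
pose i := inf (range J).
have Ji v : i <= J v by apply: ge_inf; [have [] := hasJ|exists v].
have JnE n : exists v, J v < i + n.+1%:R^-1.
  have n0 : (0 : R) < n.+1%:R^-1 by rewrite invr_gt0.
  by have [_ [v _ <-] Hv] := inf_adherent n0 hasJ; exists v.
have [v_ Hv_] := choice JnE.
have par v w : `|v - w| ^+ 2 <= 2 * (J v - i) + 2 * (J w - i).
  have E : `|2^-1 *: (v + w)| ^+ 2 = `|v + w| ^+ 2 / 4.
    by rewrite normrZ exprMn ger0_norm // mulrC; field.
  have := Ji (2^-1 *: (v + w)); rewrite /J lZ lD E.
  by rewrite (normBsq dot_norm) (normDsq dot_norm); lra.
have cv : cauchy (v_ @ \oo).
  apply: cauchy_exP => e e0; have e2 : 0 < e ^+ 2 / 4 by rewrite divr_gt0 ?exprn_gt0.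
  have [N _ HN] : \forall n \near \oo, n.+1%:R^-1 < e ^+ 2 / 4.
    exact: (near_infty_natSinv_lt (PosNum e2)).
  exists (v_ N); exists N => // n /= Nn; rewrite -ball_normE /=.
  rewrite -(@ltr_pXn2r _ 2) ?nnegrE // ?(ltW e0) //.
  have := par (v_ N) (v_ n); have := Hv_ n; have := Hv_ N.
  have /= := HN n Nn; have /= := HN N (leqnn N).
  move: (N.+1%:R^-1) (n.+1%:R^-1) (J _) (J _) (`|_| ^+ 2) (e ^+ 2) => a b c d f g.
  lra.
have [a av] : exists a : H, v_ @ \oo --> a.
  by apply/cvg_ex; exact: cauchy_cvg.
exists a => v; have [->|v0] := eqVneq v 0.
  by rewrite dot0r -(scale0r 0) lZ mul0r.
have nv : 0 < `|v| by rewrite normr_gt0.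
(* Near-minimality of [v_ n] is tested along [v] with the step d / |v|^2 that minimises [J] on that
   line. *)
have key n : (dot (v_ n) v - l v) ^+ 2 <= n.+1%:R^-1 * `|v| ^+ 2.
  set d := dot (v_ n) v - l v.
  have := Ji (v_ n + (- (d / `|v| ^+ 2)) *: v); have := Hv_ n.
  rewrite /J (normDsq dot_norm) lD lZ dotZr normrZ exprMn real_normK ?num_real //.
  move=> H1 H2.
  have H3 : 2 * (d / `|v| ^+ 2) * d - (d / `|v| ^+ 2) ^+ 2 * `|v| ^+ 2
      < n.+1%:R^-1.
    move: H1 H2; move: (d / _) (n.+1%:R^-1) => q b H1 H2.
    by rewrite /d; move: (`|v_ n| ^+ 2) (`|v| ^+ 2) H1 H2 => p r H1 H2; lra.
  have H4 : 2 * (d / `|v| ^+ 2) * d - (d / `|v| ^+ 2) ^+ 2 * `|v| ^+ 2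
     = d ^+ 2 / `|v| ^+ 2 by field; rewrite gt_eqF.
  by rewrite H4 ltr_pdivrMr ?exprn_gt0 // in H3; exact: ltW.
apply/eqP; rewrite eq_sym -subr_eq0 -normr_le0; apply/ler_addgt0Pl => e e0.
rewrite addr0.
have e1 : 0 < e / (2 * `|v|) by rewrite divr_gt0 ?mulr_gt0.
have e2 : 0 < (e / (2 * `|v|)) ^+ 2 by rewrite exprn_gt0.
near \oo => n.
have : `|a - v_ n| <= e / (2 * `|v|).
  by near: n; move/cvgrPdist_le : av; exact.
have : n.+1%:R^-1 <= (e / (2 * `|v|)) ^+ 2.
  by near: n; near do apply: ltW; exact: (near_infty_natSinv_lt (PosNum e2)).
move=> n1 n2.
have K1 : `|dot (v_ n) v - l v| <= e / 2.
  rewrite -(@ler_pXn2r _ 2) ?nnegrE // ?divr_ge0 ?(ltW e0) //.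
  rewrite real_normK ?num_real // (le_trans (key n)) //.
  have -> : (e / 2) ^+ 2 = (e / (2 * `|v|)) ^+ 2 * `|v| ^+ 2.
    by field; rewrite gt_eqF.
  by rewrite ler_wpM2r // sqr_ge0.
have K2 : `|dot (a - v_ n) v| <= e / 2.
  have -> : e / 2 = e / (2 * `|v|) * `|v| by field; rewrite gt_eqF.
  exact: ler_dot.
have -> : dot a v - l v = dot (a - v_ n) v + (dot (v_ n) v - l v).
  by rewrite dotBl; ring.
by rewrite (le_trans (ler_normD _ _)) // [e]splitr lerD.
Unshelve. all: by end_near.
Qed.

End riesz.

(** * Borel functions into separable spaces *)

Section borel_functions.

(** Stated on open sets, so that continuous maps compose and product spaces can be used as
    topological spaces, without choosing a sigma-algebra on them. *)
Definition borel_measurable (d : measure_display) (T : measurableType d)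
    (Y : topologicalType) (f : T -> Y) : Prop :=
  forall U, open U -> measurable (f @^-1` U).

Lemma borel_measurableP d (T : measurableType d) (Y : ptopologicalType)
    (f : T -> Y) :
  borel_measurable f <-> measurable_fun setT (f : T -> borel Y).
Proof.
split=> [mf|mf U oU].
  apply: (@measurability _ _ _ _ setT (f : T -> borel Y) (@open Y) erefl).
  move=> _ [U oU <-].
  by rewrite setTI; exact: mf.
by rewrite -[_ @^-1` _]setTI; apply: mf => //; exact: sub_sigma_algebra.
Qed.

Lemma borel_measurable_realP d (T : measurableType d) (R : realType)
    (f : T -> R) :
  borel_measurable f <-> measurable_fun setT f.
Proof.
split=> [mf|mf U oU].
  apply: (measurability _ (RGenOpens.measurableE R)) => // _ [U [x [y ->]] <-].
  by rewrite setTI; apply: mf; exact: interval_open.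
by rewrite -[_ @^-1` _]setTI; apply: mf => //; exact: open_measurable.
Qed.

Lemma borel_measurable_comp d (T : measurableType d) (Y W : topologicalType)
    (f : T -> Y) (F : Y -> W) :
  continuous F -> borel_measurable f -> borel_measurable (F \o f).
Proof.
move=> cF mf U oU; rewrite comp_preimage; apply: mf.
by move/continuousP : cF; exact.
Qed.

Lemma borel_measurable_cst d (T : measurableType d) (Y : topologicalType)
  (y : Y) : borel_measurable (fun _ : T => y).
Proof. by move=> U oU; rewrite preimage_cst; case: ifP. Qed.

Lemma separable_real (R : realType) : separable R.
Proof.
exists (range (@ratr R)); last exact: dense_rat.
by apply: sub_countable (card_image_le _ _) _; exact: countableP.
Qed.

Lemma separable_seq (R : realType) (Y : pseudoMetricNormedZmodType R) :
  separable Y -> exists e : nat -> Y,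
    forall y r, 0 < r -> exists i, ball y r (e i).
Proof.
move=> [D /pfcard_geP[D0|[e]] dD].
  have : (setT `&` D : set Y) !=set0 by apply: dD; [exists point|exact: openT].
  by rewrite D0 setI0 => -[].
exists e => y r r0.
have /dD : ball y r !=set0 by exists y; exact: ballxx.
move=> /(_ (ball_open _ _))[z [yz Dz]].
have [i _ ei] : (e @` setT) z by rewrite image_eq.
by exists i; rewrite ei.
Qed.

(** This is where separability acts: an open set of the product is a countable union of products of
    balls centred on dense sequences with radii [k.+1%:R^-1]. Measurability of sums and of inner
    products follows. *)
Lemma borel_measurable_pair d (T : measurableType d) (R : realType)
    (Y W : pseudoMetricNormedZmodType R) (f : T -> Y) (g : T -> W) :
  separable Y -> separable W ->
  borel_measurable f -> borel_measurable g ->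
  borel_measurable (fun t => (f t, g t)).
Proof.
move=> /separable_seq[a Ha] /separable_seq[b Hb] mf mg U oU.
pose B i j k : set (Y * W) :=
  ball (a i) k.+1%:R^-1 `*` ball (b j) k.+1%:R^-1.
suff -> : (fun t => (f t, g t)) @^-1` U =
    \bigcup_i \bigcup_j \bigcup_(k in [set k | B i j k `<=` U])
      (f @^-1` ball (a i) k.+1%:R^-1 `&` g @^-1` ball (b j) k.+1%:R^-1).
  do 2 (apply: bigcupT_measurable => ?); apply: bigcup_measurable => k _.
  by apply: measurableI; [apply: mf|apply: mg]; exact: ball_open.
apply/seteqP; split=> t /=; last first.
  by move=> [i _ [j _ [k kU [ft gt]]]]; apply: kU.
move=> Ut; have : nbhs (f t, g t) U by exact: open_nbhs_nbhs.
move=> /nbhs_ballP[e /= e0 He].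
have [k _ Hk] := near_infty_natSinv_lt (PosNum (divr_gt0 e0 (ltr0Sn R 1))).
have {}Hk : k.+1%:R^-1 < e / 2 := Hk k (leqnn k).
have k0 : 0 < k.+1%:R^-1 :> R by rewrite invr_gt0.
have [i Hi] := Ha (f t) _ k0; have [j Hj] := Hb (g t) _ k0.
exists i => //; exists j => //; exists k; last by split=> /=; exact: ball_sym.
move=> [y w] [/= yi wj]; apply: He; split=> /=.
  apply: (@le_ball _ _ _ (k.+1%:R^-1 + k.+1%:R^-1)).
    by rewrite [e]splitr lerD // ltW.
  exact: ball_triangle Hi yi.
apply: (@le_ball _ _ _ (k.+1%:R^-1 + k.+1%:R^-1)).
  by rewrite [e]splitr lerD // ltW.
exact: ball_triangle Hj wj.
Qed.

Lemma borel_measurable_comp2 d (T : measurableType d) (R : realType)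
    (Y W : pseudoMetricNormedZmodType R) (Q : topologicalType)
    (f : T -> Y) (g : T -> W) (F : Y * W -> Q) :
  separable Y -> separable W -> continuous F ->
  borel_measurable f -> borel_measurable g ->
  borel_measurable (fun t => F (f t, g t)).
Proof.
move=> sY sW cF mf mg.
by apply: (borel_measurable_comp cF); exact: borel_measurable_pair.
Qed.

End borel_functions.

Section borel_normed.
Context (R : realType) (H : normedModType R).
Hypothesis sepH : separable H.
Context d (T : measurableType d).
Implicit Types (f g : T -> H) (r : T -> R).

Lemma borel_measurable_add f g : borel_measurable f -> borel_measurable g ->
  borel_measurable (fun t => f t + g t).
Proof.
apply: (@borel_measurable_comp2 _ _ _ _ _ _ _ _ (fun z => z.1 + z.2)) => //.
exact: add_continuous.
Qed.

Lemma borel_measurable_scale r f : measurable_fun setT r ->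
  borel_measurable f -> borel_measurable (fun t => r t *: f t).
Proof.
move=> /borel_measurable_realP mr.
apply: (@borel_measurable_comp2 _ _ R R H _ _ _ (fun z => z.1 *: z.2)) => //.
  exact: separable_real.
exact: scale_continuous.
Qed.

Lemma borel_measurable_opp f : borel_measurable f ->
  borel_measurable (fun t => - f t).
Proof. exact/borel_measurable_comp/opp_continuous. Qed.

Lemma borel_measurable_sub f g : borel_measurable f -> borel_measurable g ->
  borel_measurable (fun t => f t - g t).
Proof.
by move=> mf mg; apply: borel_measurable_add => //; exact: borel_measurable_opp.
Qed.

Lemma measurable_norm f : borel_measurable f ->
  measurable_fun setT (fun t => `|f t|).
Proof.
move=> mf; apply/borel_measurable_realP.
exact: (borel_measurable_comp (@norm_continuous _ _)).
Qed.

Lemma borel_measurable_direction f : borel_measurable f ->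
  borel_measurable (fun t => direction (f t)).
Proof.
move=> mf; apply: borel_measurable_scale => //.
under eq_fun do rewrite -powR_inv1 //.
by apply: (measurableT_comp (measurable_powR _)); exact: measurable_norm.
Qed.

Lemma measurable_dot (dot : {dot H for idfun}) f g : induces_norm dot ->
  borel_measurable f -> borel_measurable g ->
  measurable_fun setT (fun t => dot (f t) (g t)).
Proof.
move=> dn mf mg; under eq_fun do rewrite dot_polar //.
apply: measurable_funM => //; apply: measurable_funB.
  by apply: measurable_funD; apply: measurable_funX; exact: measurable_norm.
by apply: measurable_funX; apply: measurable_norm; exact: borel_measurable_sub.
Qed.

End borel_normed.

(** * The gradient of the median objective *)

Section real_expectation.
Context d (T : measurableType d) (R : realType) (P : probability T R).
Implicit Types (f g : T -> R).
Local Notation integ f := (P.-integrable setT (EFin \o f)).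

Lemma bounded_integrable f M : measurable_fun setT f ->
  (forall t, `|f t| <= M) -> integ f.
Proof.
move=> mf bf; apply: measurable_bounded_integrable => //.
  by rewrite ltey_eq fin_num_measure.
exists M; split; first exact: num_real.
by move=> x Mx t _; exact: le_trans (bf t) (ltW Mx).
Qed.

Lemma Rintegrable_measurable f : integ f -> measurable_fun setT f.
Proof. by move=> /integrableP[/measurable_EFinP]. Qed.

Lemma RintegrableD f g : integ f -> integ g -> integ (fun t => f t + g t).
Proof.
move=> If Ig; rewrite (_ : EFin \o _ = (EFin \o f) \+ (EFin \o g))%E //.
exact: integrableD.
Qed.

Lemma RintegrableB f g : integ f -> integ g -> integ (fun t => f t - g t).
Proof.
move=> If Ig; rewrite (_ : EFin \o _ = (EFin \o f) \- (EFin \o g))%E //.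
exact: integrableB.
Qed.

Lemma RintegrableZ (a : R) f : integ f -> integ (fun t => a * f t).
Proof.
move=> If; rewrite (_ : EFin \o _ = (fun x => a%:E * (EFin \o f) x))%E //.
exact: integrableZl.
Qed.

Lemma Rintegral_cstP (a : R) : \int[P]_t a = a.
Proof. by rewrite Rintegral_cst //= [X in fine X](probability_setT P) mulr1. Qed.

Lemma ae_le_Rintegral f g : integ f -> integ g ->
  {ae P, forall t, f t <= g t} -> \int[P]_t f t <= \int[P]_t g t.
Proof.
move=> If Ig fg; rewrite -subr_ge0 -RintegralB //.
have mgf : measurable_fun setT (fun t => g t - f t).
  by apply: measurable_funB; exact: Rintegrable_measurable.
rewrite /Rintegral (@ae_eq_integral _ _ _ P _ (fun t => `|g t - f t|%:E)) //.
- by rewrite fine_ge0 // integral_ge0.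
- exact/measurable_EFinP.
- by apply/measurable_EFinP; exact: measurableT_comp.
- by apply: filterS fg => t fg _; rewrite ger0_norm // subr_ge0.
Qed.

Lemma Rintegral_eq0_ae f : integ f -> (forall t, 0 <= f t) ->
  \int[P]_t f t = 0 -> {ae P, forall t, f t = 0}.
Proof.
move=> If f0 E.
have Efin : (\int[P]_t (f t)%:E = 0)%E.
  rewrite -[LHS]fineK; last exact: integrable_fin_num If.
  by rewrite -/(Rintegral P setT f) E.
have /(ae_eq_integral_abs P measurableT) : measurable_fun setT (EFin \o f).
  by have /integrableP[] := If.
move=> [+ _]; have -> : (\int[P]_x `|(EFin \o f) x| = \int[P]_x (f x)%:E)%E.
  by apply: eq_integral => t _; rewrite /= ger0_norm.
move=> /(_ Efin); apply: filterS => t /(_ I) /= H0.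
by apply/eqP; rewrite -eqe H0.
Qed.

Lemma ae_probability_exists (Q : T -> Prop) :
  {ae P, forall t, Q t} -> exists t, Q t.
Proof.
move=> aeQ; apply: contrapT => /forallNP nQ.
have [A [mA A0 sA]] := aeQ.
have AT : A = setT.
  by apply/seteqP; split=> // t _; apply: sA; exact: nQ.
by move: A0; rewrite AT probability_setT => /eqP; rewrite onee_eq0.
Qed.

Lemma measurable_inv_ge0 f : measurable_fun setT f -> (forall t, 0 <= f t) ->
  measurable_fun setT (fun t => (f t)^-1).
Proof.
move=> mf f0; under eq_fun do rewrite -powR_inv1 //.
exact: (measurableT_comp (measurable_powR _)).
Qed.

(** The extended inverse is +oo at 0, so a finite integral excludes zeros of [f] up to a null set;
    it dominates the real inverse everywhere. *)
Lemma inverse_moment f (C : R) : measurable_fun setT f ->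
  (forall t, 0 <= f t) -> (\int[P]_t ((f t)%:E)^-1 <= C%:E)%E ->
  [/\ {ae P, forall t, f t != 0}, integ (fun t => (f t)^-1) &
      \int[P]_t (f t)^-1 <= C].
Proof.
move=> mf f0 HC.
have mV := measurable_inv_ge0 mf f0.
have mg : measurable_fun setT (fun t => ((f t)%:E)^-1)%E.
  under eq_fun do rewrite inver.
  apply: measurable_fun_ifT => //; last exact/measurable_EFinP.
  exact: measurable_fun_eqr.
have g0 t : (0 <= ((f t)%:E)^-1)%E by rewrite inve_ge0 lee_fin.
have Ig : P.-integrable setT (fun t => ((f t)%:E)^-1)%E.
  apply/integrableP; split=> //.
  under eq_integral do rewrite gee0_abs //.
  exact: le_lt_trans HC (ltry _).
have le_g t : (((f t)^-1)%:E <= ((f t)%:E)^-1)%E.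
  by rewrite inver; case: ifP => // _; rewrite leey.
have IV : integ (fun t => (f t)^-1).
  apply: le_integrable Ig => //; first exact/measurable_EFinP.
  move=> t _; rewrite (gee0_abs (g0 t)) gee0_abs //=.
  by rewrite lee_fin invr_ge0.
split=> //.
  have := integrable_ae measurableT Ig; apply: filterS => t /(_ I).
  by rewrite inver; case: eqP.
rewrite -lee_fin /Rintegral fineK; last exact: integrable_fin_num IV.
apply: le_trans HC; apply: ge0_le_integral => //.
- by move=> t _; rewrite lee_fin invr_ge0.
- exact/measurable_EFinP.
Qed.

Lemma variance_ae_cst f (a : R) : measurable_fun setT f ->
  {ae P, forall t, f t = a} -> variance P f = 0%E.
Proof.
move=> mf fa.
have E : ('E_P[f] = a%:E)%E.
  rewrite unlock (@ae_eq_integral _ _ _ P _ (cst a%:E)) //.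
  - by rewrite integral_cst //= (probability_setT P) mule1.
  - exact/measurable_EFinP.
  - by apply: filterS fa => t fat _ /=; rewrite fat.
rewrite /variance covariance.unlock E unlock.
rewrite (@ae_eq_integral _ _ _ P _ (cst 0%E)) //.
- by rewrite integral0.
- by apply/measurable_EFinP; apply: measurable_funM; exact: measurable_funB.
- by apply: filterS fa => t fat _; rewrite /= fctE /= fat subrr mul0r.
Qed.

End real_expectation.

Section gradient.
Context (R : realType) (H : completeNormedModType R).
Context (dot : {dot H for idfun}) (dot_norm : induces_norm dot).
Context (H_separable : separable H).
Context d (T : measurableType d) (P : probability T R).
Context (X : {RV P >-> borel H}).
Local Notation integ f := (P.-integrable setT (EFin \o f)).
Let dir h t : H := direction (X t - h).

Lemma borel_measurable_rv : borel_measurable (X : T -> H).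
Proof. by apply/borel_measurableP; exact: measurable_funPT. Qed.

Lemma borel_measurable_dir h : borel_measurable (dir h).
Proof.
apply: borel_measurable_direction => //; apply: borel_measurable_sub => //.
  exact: borel_measurable_rv.
exact: borel_measurable_cst.
Qed.

Lemma measurable_dist h : measurable_fun setT (fun t => `|X t - h|).
Proof.
apply: measurable_norm; apply: borel_measurable_sub => //.
  exact: borel_measurable_rv.
exact: borel_measurable_cst.
Qed.

Lemma measurable_dir_dot h v : measurable_fun setT (fun t => dot (dir h t) v).
Proof.
apply: measurable_dot => //; first exact: borel_measurable_dir.
exact: borel_measurable_cst.
Qed.

Lemma dir_dot_le h v t : `|dot (dir h t) v| <= `|v|.
Proof. by rewrite -[leRHS]mul1r ler_dot // norm_direction_le1. Qed.

Lemma integrable_dir_dot h v : integ (fun t => dot (dir h t) v).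
Proof. exact: bounded_integrable (measurable_dir_dot h v) (dir_dot_le h v). Qed.

(** A weak integral: v |-> - E <direction (X - h), v> is linear and bounded by |v|, hence
    represented by a vector. Only pairings with vectors are ever integrated. *)
Lemma gradient_exists : exists Phi : H -> H,
  forall h v, dot (Phi h) v = - \int[P]_t dot (dir h t) v.
Proof.
suff /choice : forall h, exists p, forall v,
  dot p v = - \int[P]_t dot (dir h t) v.
  by move=> [Phi HPhi]; exists Phi.
move=> h; have [|||a Ha] := @riesz_representation _ _ _ dot_norm
    (fun v => - \int[P]_t dot (dir h t) v) 1.
- move=> u v; rewrite -opprD -RintegralD //; try exact: integrable_dir_dot.
  by congr (- _); apply: eq_Rintegral => t _; rewrite dotDr.
- move=> a u; rewrite mulrN -RintegralZl //; last exact: integrable_dir_dot.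
  by congr (- _); apply: eq_Rintegral => t _; rewrite dotZr.
- move=> v; rewrite normrN mul1r -[leRHS](Rintegral_cstP P).
  apply: le_trans (le_normr_Rintegral measurableT (integrable_dir_dot h v)) _.
  apply: le_Rintegral => //.
  + exact/integrable_norm/integrable_dir_dot.
  + by apply: (@bounded_integrable _ _ _ _ _ `|v|) => // t; rewrite normr_id.
  + by move=> t _; exact: dir_dot_le.
by exists a => v; rewrite Ha.
Qed.

Context (m : H) (C : R) (C_gt0 : 0 < C).
Hypothesis A2 : forall h : H,
  (\int[P]_w (`|X w - h|%:E)^-1 <= C%:E)%E /\
  (\int[P]_w ((`|X w - h| ^+ 2)%:E)^-1 <= C%:E)%E.
Hypothesis A1 : assumption_A1 P dot X.
Hypothesis m_median : geometric_median P X m.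
Context (Phi : H -> H).
Hypothesis PhiE : forall h v, dot (Phi h) v = - \int[P]_t dot (dir h t) v.

Let inv1 h : [/\ {ae P, forall t, `|X t - h| != 0},
  integ (fun t => `|X t - h|^-1) & \int[P]_t `|X t - h|^-1 <= C].
Proof.
by apply: inverse_moment; [exact: measurable_dist|by []|case: (A2 h)].
Qed.

Let inv2 h : [/\ {ae P, forall t, `|X t - h| ^+ 2 != 0},
  integ (fun t => `|X t - h| ^- 2) & \int[P]_t `|X t - h| ^- 2 <= C].
Proof.
apply: inverse_moment; [|by move=> t; exact: sqr_ge0|by case: (A2 h)].
exact/measurable_funX/measurable_dist.
Qed.

Let ae_neq h : {ae P, forall t, X t - h != 0}.
Proof. by have [+ _ _] := inv1 h; apply: filterS => t; rewrite normr_eq0. Qed.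

Lemma gradient_le1 h : `|Phi h| <= 1.
Proof.
have [->|p0] := eqVneq (Phi h) 0; first by rewrite normr0.
have : `|Phi h| * `|Phi h| <= 1 * `|Phi h|.
  rewrite mul1r -expr2 -dot_norm PhiE (le_trans (ler_norm _)) // normrN.
  apply: le_trans (le_normr_Rintegral measurableT (integrable_dir_dot _ _)) _.
  rewrite -[leRHS](Rintegral_cstP P); apply: le_Rintegral => //.
  - exact/integrable_norm/integrable_dir_dot.
  - by apply: (@bounded_integrable _ _ _ _ _ `|Phi h|) => // t; rewrite normr_id.
  - by move=> t _; exact: dir_dot_le.
by rewrite ler_pM2r // normr_gt0.
Qed.

Lemma gradient_diff h h' v :
  dot (Phi h - Phi h') v = \int[P]_t dot (dir h' t - dir h t) v.
Proof.
rewrite dotBl !PhiE opprK addrC -RintegralB //; try exact: integrable_dir_dot.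
by apply: eq_Rintegral => t _; rewrite dotBl.
Qed.

Let integrable_dir_diff h h' v : integ (fun t => dot (dir h' t - dir h t) v).
Proof.
under eq_fun do rewrite dotBl.
by apply: RintegrableB => //; exact: integrable_dir_dot.
Qed.

Lemma gradient_diff_dot_le h h' v :
  dot (Phi h - Phi h') v <= 2 * C * `|h - h'| * `|v|.
Proof.
have [_ I1 C1] := inv1 h'.
rewrite gradient_diff.
apply: (@le_trans _ _ (\int[P]_t (2 * `|h - h'| * `|v| * `|X t - h'|^-1))).
  apply: ae_le_Rintegral => //; first exact: RintegrableZ.
  apply: filterS (ae_neq h') => t x0.
  rewrite (le_trans (ler_norm _)) // mulrAC ler_dot //.
  rewrite (le_trans (direction_lipschitz _ x0)) //.
  by rewrite (_ : X t - h' - (X t - h) = h - h') // opprB addrC addrA subrK.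
rewrite RintegralZl //.
have -> : 2 * C * `|h - h'| * `|v| = 2 * `|h - h'| * `|v| * C by ring.
by rewrite ler_wpM2l // !mulr_ge0.
Qed.

Lemma gradient_lipschitz h h' : `|Phi h - Phi h'| <= 2 * C * `|h - h'|.
Proof.
have [->|p0] := eqVneq (Phi h - Phi h') 0.
  by rewrite normr0 !mulr_ge0 // ltW.
have := gradient_diff_dot_le h h' (Phi h - Phi h').
by rewrite dot_norm expr2 ler_pM2r // normr_gt0.
Qed.

Lemma gradient_continuous : continuous Phi.
Proof.
move=> h; apply/cvgrPdist_le => e e0.
have k0 : 0 < e / (2 * C) by rewrite divr_gt0 // mulr_gt0.
have /cvgrPdist_le/(_ _ k0) : (h : H) @[h --> h] --> h by exact: cvg_id.
apply: filterS => h' hh'.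
by rewrite (le_trans (gradient_lipschitz _ _)) // mulrC -ler_pdivlMr ?mulr_gt0.
Qed.

Let integrable_norm_diff h : integ (fun t => `|X t - h| - `|X t|).
Proof.
apply: (@bounded_integrable _ _ _ _ _ `|h|).
  apply: measurable_funB; first exact: measurable_dist.
  by apply: measurable_norm; exact: borel_measurable_rv.
move=> t; apply: le_trans (ler_dist_dist _ _) _.
by rewrite -addrAC subrr add0r normrN.
Qed.

(** Minimality and the subgradient inequality give <Phi (m + s v), v> >= 0 for every s > 0, without
    differentiating under the expectation. The Lipschitz bound then carries this back to [m] along v
    = - Phi m. *)
Lemma gradient_median : Phi m = 0.
Proof.
have key v s : 0 < s -> 0 <= dot (Phi (m + s *: v)) v.
  move=> s0; set h := m + s *: v.
  have := m_median h; rewrite !unlock.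
  have If := integrable_norm_diff.
  rewrite -[X in (X <= _)%E]fineK; last exact: integrable_fin_num (If m).
  rewrite -[X in (_ <= X)%E]fineK; last exact: integrable_fin_num (If h).
  rewrite lee_fin -!/(Rintegral _ _ _) -subr_ge0 -RintegralB // => H0.
  rewrite -(pmulr_rge0 _ s0) PhiE mulrN -mulNr -RintegralZl //; last first.
    exact: integrable_dir_dot.
  apply: le_trans H0 _; apply: le_Rintegral => //.
  - exact: RintegrableB.
  - exact/RintegrableZ/integrable_dir_dot.
  move=> t _; have -> : `|X t - h| - `|X t| - (`|X t - m| - `|X t|) =
    `|X t - h| - `|X t - m| by ring.
  have := norm_convex dot_norm (X t - h) (X t - m).
  have -> : X t - h - (X t - m) = (- s) *: v.
    by rewrite opprB addrC addrA subrK /h opprD addrA subrr sub0r scaleNr.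
  by rewrite dotZr.
apply/eqP; rewrite -normr_eq0 -sqrf_eq0 eq_le sqr_ge0 andbT.
(* With this step, the Lipschitz constant 2 C costs only half of |Phi m|^2, which forces |Phi m|^2
   <= 0. *)
have s0 : 0 < (4 * C)^-1 by rewrite invr_gt0 mulr_gt0.
have := key (- Phi m) _ s0.
have := gradient_diff_dot_le (m + (4 * C)^-1 *: - Phi m) m (- Phi m).
rewrite dotBl [m + _]addrC addrK normrZ !normrN gtr0_norm //.
rewrite -[X in dot (Phi m) X]scaleN1r dotZr dot_norm.
have -> : 2 * C * ((4 * C)^-1 * `|Phi m|) * `|Phi m| = `|Phi m| ^+ 2 / 2.
  by field; rewrite gt_eqF.
by move: (dot _ _) (`|_| ^+ 2) => a b; lra.
Qed.

(** A bounded weight below 1 / |X - m|. The same weighted curvature bounds from below both the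
    Hessian at [m] and the global monotonicity of the gradient. *)
Let weight t : R := (1 + `|X t - m|)^-1.

Let weight_gt0 t : 0 < weight t.
Proof. by rewrite invr_gt0 ltr_pwDl. Qed.

Let weight_le1 t : weight t <= 1.
Proof. by rewrite invf_le1 ?ltr_pwDl // lerDl. Qed.

Let measurable_weight : measurable_fun setT weight.
Proof.
apply: measurable_inv_ge0; last by move=> t; rewrite addr_ge0.
by apply: measurable_funD => //; exact: measurable_dist.
Qed.

Let sine v t : R := 1 - dot (dir m t) v ^+ 2.

Let dir_sq_le v t : `|v| <= 1 -> dot (dir m t) v ^+ 2 <= 1.
Proof.
move=> v1; rewrite -[X in X <= _]real_normK ?num_real //.
by rewrite expr_le1 // (le_trans (dir_dot_le _ _ _)).
Qed.

Let wsine_bound v t : `|v| <= 1 -> 0 <= weight t * sine v t <= 1.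
Proof.
move=> v1; have := @dir_sq_le v t v1; have := sqr_ge0 (dot (dir m t) v).
rewrite /sine; have := weight_gt0 t; have := weight_le1 t.
by move: (weight t) (_ ^+ 2) => a b ? ? ? ?; apply/andP; split; nra.
Qed.

Let measurable_wsine v : measurable_fun setT (fun t => weight t * sine v t).
Proof.
apply: measurable_funM => //; apply: measurable_funB => //.
exact/measurable_funX/measurable_dir_dot.
Qed.

Let integrable_wsine v : `|v| <= 1 -> integ (fun t => weight t * sine v t).
Proof.
move=> v1; apply: (@bounded_integrable _ _ _ _ _ 1) (measurable_wsine v) _.
by move=> t; have /andP[? ?] := @wsine_bound v t v1; rewrite ger0_norm.
Qed.

(** If the sine vanishes almost surely, X - m lies on the line of [v]; a vector orthogonal to [v]
    then has an almost surely constant product with [X], against (A1). *)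
Lemma ae_aligned_contradiction v : `|v| <= 1 ->
  \int[P]_t (weight t * sine v t) = 0 -> False.
Proof.
move=> v1 I0.
have ae1 : {ae P, forall t, dot (dir m t) v ^+ 2 = 1}.
  have := @Rintegral_eq0_ae _ _ _ P _ (integrable_wsine v1) _ I0.
  move=> /(_ (fun t => proj1 (andP (wsine_bound t v1)))).
  apply: filterS => t /eqP; rewrite mulf_eq0 gt_eqF //= subr_eq0.
  by rewrite eq_sym => /eqP.
have [t0 Ht0] := ae_probability_exists ae1.
have [h' [vh']] := A1 v.
have -> : variance P (fun w => dot (X w) h') = 0%E; last by rewrite ltxx.
apply: (@variance_ae_cst _ _ _ _ _ (dot m h')).
  apply: measurable_dot => //; first exact: borel_measurable_rv.
  exact: borel_measurable_cst.
apply: filterS ae1 => t a1.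
(* The equality case of Cauchy-Schwarz for two vectors of norm at most 1. *)
have sv : dir m t = dot (dir m t) v *: v.
  apply/eqP; rewrite -subr_eq0 -normr_eq0 -sqrf_eq0 eq_le sqr_ge0 andbT.
  have s2 : `|dir m t| ^+ 2 <= 1 by rewrite expr_le1 // norm_direction_le1.
  have v2 : `|v| ^+ 2 <= 1 by rewrite expr_le1.
  rewrite (normBsq dot_norm) dotZr -expr2 a1 (normrZ _ v) exprMn.
  by rewrite real_normK ?num_real // a1; move: (`|_| ^+ 2) s2 v2 => a; lra.
apply/eqP; rewrite -subr_eq0 -dotBl -(normZ_direction (X t - m)).
by rewrite -/(dir m t) sv !dotZl vh' !mulr0.
Qed.

(* The sine distance from the direction of [X t - m] to a fixed line is, after
   averaging over [t], bounded below: two independent copies of [X] span an angle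
   that is positive on average, and the sine satisfies the triangle inequality. *)
Lemma sine_average_lower_bound : exists2 lam : R, 0 < lam &
  forall u, `|u| = 1 -> lam <= \int[P]_t (weight t * sine u t).
Proof.
(* [t'] plays the independent copy: [g t] is the mean weighted squared sine between the direction of
   a fresh sample and that of [X t - m]. *)
pose g t := \int[P]_t' (weight t' * sine (dir m t) t').
have d1 t : `|dir m t| <= 1 by exact: norm_direction_le1.
have mg : measurable_fun setT g.
  pose f (z : T * T) : \bar R := (weight z.2 * sine (dir m z.1) z.2)%:E.
  have mf : measurable_fun setT f.
    apply/measurable_EFinP; apply: measurable_funM.
      exact: (measurableT_comp measurable_weight).
    apply: measurable_funB => //; apply: measurable_funX.
    have mdir := borel_measurable_dir m.
    by apply: measurable_dot => //; apply/borel_measurableP;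
      apply: (measurableT_comp (T2 := T)) => //; exact/borel_measurableP.
  have := @measurable_fun_fubini_tonelli_F _ _ _ _ R P f mf.
  move=> /(_ (fun z => _)) mF.
  apply: (measurableT_comp (fine_measurable _)) (mF _) => // z.
  by rewrite lee_fin; have /andP[] := @wsine_bound (dir m z.1) z.2 (d1 _).
have g01 t : 0 <= g t <= 1.
  rewrite Rintegral_ge0 /=; last first.
    by move=> t' _; have /andP[] := @wsine_bound (dir m t) t' (d1 _).
  rewrite -[leRHS](Rintegral_cstP P); apply: le_Rintegral => //.
  - exact: integrable_wsine.
  - by apply: (@bounded_integrable _ _ _ _ _ 1) => // t'; rewrite normr1.
  - by move=> t' _; have /andP[] := @wsine_bound (dir m t) t' (d1 _).
have wg01 t : 0 <= weight t * g t <= 1.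
  have := g01 t; have := weight_gt0 t; have := weight_le1 t.
  by move: (weight t) (g t) => a b ? ? /andP[? ?]; apply/andP; split; nra.
have Iwg : integ (fun t => weight t * g t).
  apply: (@bounded_integrable _ _ _ _ _ 1); first exact: measurable_funM.
  by move=> t; have /andP[? ?] := wg01 t; rewrite ger0_norm.
(* Since weights are at most 1, the sine inequality averaged over [t'] gives g t <= 2 S + 2 sine u
   t; weighting and averaging over [t] then gives at most 4 S. *)
exists ((\int[P]_t (weight t * g t)) / 4).
  rewrite divr_gt0 // lt_neqAle Rintegral_ge0 ?andbT; last first.
    by move=> t _; have /andP[] := wg01 t.
  apply/negP => /eqP/esym I0.
  have := @Rintegral_eq0_ae _ _ _ P _ Iwg _ I0.
  move=> /(_ (fun t => proj1 (andP (wg01 t)))).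
  (* A vanishing double average yields one [t] with [g t = 0], so almost all directions are aligned
     with [dir m t]. *)
  move=> /ae_probability_exists[t /eqP]; rewrite mulf_eq0 gt_eqF //= => /eqP.
  exact: ae_aligned_contradiction.
move=> u u1; have u1' : `|u| <= 1 by rewrite u1.
set S := \int[P]_t (weight t * sine u t).
have g_le t : g t <= 2 * S + 2 * sine u t.
  have -> : 2 * S + 2 * sine u t = \int[P]_t'
      (2 * (weight t' * sine u t') + 2 * sine u t).
    rewrite RintegralD //; last 2 first.
    - exact/RintegrableZ/integrable_wsine.
    - exact: (@bounded_integrable _ _ _ _ _ `|2 * sine u t|).
    by rewrite RintegralZl ?Rintegral_cstP //; exact: integrable_wsine.
  apply: le_Rintegral => //.
  - exact: integrable_wsine.
  - apply: RintegrableD; first exact/RintegrableZ/integrable_wsine.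
    exact: (@bounded_integrable _ _ _ _ _ `|2 * sine u t|).
  move=> t' _; have s1 := norm_direction_sq (X t' - m).
  have s2 := norm_direction_sq (X t - m).
  have := sine_triangle dot_norm s1 s2 u1.
  have := @dir_sq_le u t u1'; have := @dir_sq_le u t' u1'.
  rewrite /sine -!/(dir m _); have := weight_gt0 t'; have := weight_le1 t'.
  move: (weight t') (dot (dir m t') u ^+ 2) (dot (dir m t) u ^+ 2).
  by move: (dot (dir m t') (dir m t) ^+ 2) => a w b c; nra.
rewrite ler_pdivrMr //.
have -> : S * 4 = 2 * S + 2 * S by ring.
have S0 : 0 <= S.
  by apply: Rintegral_ge0 => t _; have /andP[] := @wsine_bound u t u1'.
have -> : 2 * S + 2 * S = \int[P]_t (2 * S + 2 * (weight t * sine u t)).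
  rewrite RintegralD //; last 2 first.
  - exact: (@bounded_integrable _ _ _ _ _ `|2 * S|).
  - exact/RintegrableZ/integrable_wsine.
  by rewrite RintegralZl ?Rintegral_cstP //; exact: integrable_wsine.
apply: le_Rintegral => //.
  apply: RintegrableD; last exact/RintegrableZ/integrable_wsine.
  exact: (@bounded_integrable _ _ _ _ _ `|2 * S|).
move=> t _; have := g_le t; have := weight_gt0 t; have := weight_le1 t.
by move: S0; move: (weight t) (g t) (sine u t) => a b e ? ? ? ?; nra.
Qed.

Let curv u t : R := `|u| ^+ 2 - dot (dir m t) u ^+ 2.

Let curv_ge0 u t : 0 <= curv u t.
Proof.
rewrite subr_ge0 -[X in X <= _]real_normK ?num_real // ler_pXn2r ?nnegrE //.
exact: dir_dot_le.
Qed.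

Let integrable_wcurv u : integ (fun t => weight t * curv u t).
Proof.
apply: (@bounded_integrable _ _ _ _ _ (`|u| ^+ 2)).
  apply: measurable_funM => //; apply: measurable_funB => //.
  exact/measurable_funX/measurable_dir_dot.
move=> t; rewrite ger0_norm ?mulr_ge0 // ?(ltW (weight_gt0 t)) //.
rewrite -[leRHS]mul1r ler_pM // ?(ltW (weight_gt0 t)) //.
by rewrite gerBl sqr_ge0.
Qed.

Lemma curvature_lower_bound : exists2 lam : R, 0 < lam &
  forall u, lam * `|u| ^+ 2 <= \int[P]_t (weight t * curv u t).
Proof.
have [lam lam0 Hlam] := sine_average_lower_bound.
exists lam => // u; have [->|u0] := eqVneq u 0.
  rewrite normr0 expr0n mulr0; apply: Rintegral_ge0 => t _.
  by rewrite mulr_ge0 // ltW.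
have d1 := norm_direction u0.
have -> : \int[P]_t (weight t * curv u t) =
    `|u| ^+ 2 * \int[P]_t (weight t * sine (direction u) t).
  rewrite -RintegralZl //; last by apply: integrable_wsine; rewrite d1.
  apply: eq_Rintegral => t _.
  by rewrite /curv -{2}(normZ_direction u) dotZr /sine; ring.
by rewrite mulrC ler_wpM2l ?sqr_ge0 // Hlam.
Qed.

(** Integrates [direction_monotone]. The inequality a + b <= (1 + a) (1 + b) separates |X - m| from
    |h - m|, leaving the weight under the integral and 1 + |h - m| outside. *)
Lemma gradient_monotone lam h :
  (forall u, lam * `|u| ^+ 2 <= \int[P]_t (weight t * curv u t)) ->
  lam * `|h - m| ^+ 2 / (2 * (1 + `|h - m|)) <= dot (Phi h) (h - m).
Proof.
move=> Hlam; set k := h - m.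
have -> : dot (Phi h) k = \int[P]_t dot (dir m t - dir h t) k.
  by rewrite -gradient_diff gradient_median subr0.
have k0 : 0 < 2 * (1 + `|k|) by rewrite mulr_gt0 // ltr_pwDl.
rewrite mulrC; apply: le_trans (_ : (2 * (1 + `|k|))^-1 *
  \int[P]_t (weight t * curv k t) <= _).
  by rewrite ler_wpM2l // invr_ge0 ltW.
rewrite -RintegralZl //; apply: le_Rintegral => //; first exact: RintegrableZ.
move=> t _; have := direction_monotone dot_norm (X t - m) k.
have -> : X t - m - k = X t - h by rewrite /k opprB addrA subrK.
rewrite -!/(dir _ t) -/(curv k t); apply: le_trans.
have [->|kn0] := eqVneq k 0.
  by rewrite /curv normr0 dot0r expr0n subrr mulr0 mul0r mulr0.
have nk : 0 < `|k| by rewrite normr_gt0.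
rewrite mulrA [leRHS]mulrC ler_wpM2r // -invfM lef_pV2 ?posrE //.
- have := normr_ge0 (X t - m); move: nk; move: (`|X t - m|) (`|k|) => a b ? ?.
  nra.
- by rewrite mulr_gt0 // ltr_wpDl.
Qed.

(** The Hessian of the objective at [m], as a bilinear form; by (A2) its integrand is integrable. *)
Let hess h u : R := \int[P]_t
  ((dot h u - dot (dir m t) h * dot (dir m t) u) * `|X t - m|^-1).

Let integrable_hess h u : integ (fun t =>
  (dot h u - dot (dir m t) h * dot (dir m t) u) * `|X t - m|^-1).
Proof.
have [_ I1 _] := inv1 m.
apply: le_integrable (RintegrableZ (2 * `|h| * `|u|) I1) => //.
  apply/measurable_EFinP; apply: measurable_funM.
    apply: measurable_funB => //.
    by apply: measurable_funM; exact: measurable_dir_dot.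
  by apply: measurable_inv_ge0 => //; exact: measurable_dist.
move=> t _; rewrite lee_fin !(normrM _ (`|X t - m|^-1)) ler_wpM2r //.
rewrite [leRHS]ger0_norm ?mulr_ge0 // (le_trans (ler_normB _ _)) //.
rewrite -mulrA [leRHS]mulr_natl mulr2n lerD ?dot_le // normrM.
by rewrite ler_pM // dir_dot_le.
Qed.

Let hess_sum (r : seq nat) (F : nat -> H) (u : H) :
  hess (\sum_(k <- r) F k) u = \sum_(k <- r) hess (F k) u.
Proof.
elim: r => [|k r IH].
  rewrite !big_nil /hess -[RHS](Rintegral_cstP P); apply: eq_Rintegral => t _.
  by rewrite dot0r dot0l mul0r subrr mul0r.
rewrite !big_cons -IH /hess -RintegralD //; apply: eq_Rintegral => t _.
by rewrite dotDr dotDl; ring.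
Qed.

Let hessZ a h u : hess (a *: h) u = a * hess h u.
Proof.
rewrite /hess -RintegralZl //; apply: eq_Rintegral => t _.
by rewrite dotZr dotZl; ring.
Qed.

Let hess_coercive u : \int[P]_t (weight t * curv u t) <= hess u u.
Proof.
apply: ae_le_Rintegral => //; apply: filterS (ae_neq m) => t x0.
have nx : 0 < `|X t - m| by rewrite normr_gt0.
rewrite dot_norm -expr2 mulrC ler_wpM2l ?curv_ge0 // /weight lef_pV2 ?posrE //.
by rewrite lerDr.
Qed.

Let hess_taylor h u :
  `|dot (Phi (m + h)) u - hess h u| <= 4 * C * `|h| ^+ 2 * `|u|.
Proof.
have [_ I2 C2] := inv2 m.
have -> : dot (Phi (m + h)) u = \int[P]_t dot (dir m t - dir (m + h) t) u.
  by rewrite -gradient_diff gradient_median subr0.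
rewrite /hess -RintegralB //.
have Id : integ (fun t => dot (dir m t - dir (m + h) t) u -
   (dot h u - dot (dir m t) h * dot (dir m t) u) * `|X t - m|^-1).
  exact: RintegrableB.
apply: le_trans (le_normr_Rintegral measurableT Id) _.
apply: (@le_trans _ _ (\int[P]_t (4 * `|h| ^+ 2 * `|u| * `|X t - m| ^- 2))).
  apply: ae_le_Rintegral.
  - exact/integrable_norm.
  - exact: RintegrableZ.
  apply: filterS (ae_neq m) => t x0.
  have := direction_taylor dot_norm h u x0.
  by rewrite -addrA -opprD.
rewrite RintegralZl //.
have -> : 4 * C * `|h| ^+ 2 * `|u| = 4 * `|h| ^+ 2 * `|u| * C by ring.
by rewrite ler_wpM2l // !mulr_ge0.
Qed.

(** Linearity of [hess] in its first argument turns the sum of the linearised gradients into the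
    Hessian at the average. Testing with the average [u] itself, coercivity gives lam |u|^2, and one
    factor |u| cancels. *)
Lemma average_le_gradient_average lam (F : nat -> H) n :
  (forall u, lam * `|u| ^+ 2 <= \int[P]_t (weight t * curv u t)) ->
  lam * `|n%:R^-1 *: \sum_(1 <= k < n.+1) F k| <=
  n%:R^-1 * (`|\sum_(1 <= k < n.+1) Phi (m + F k)| +
             4 * C * \sum_(1 <= k < n.+1) `|F k| ^+ 2).
Proof.
move=> Hlam; set u := _ *: _.
have [->|u0] := eqVneq u 0.
  rewrite normr0 mulr0 mulr_ge0 // addr_ge0 // mulr_ge0 //.
    by rewrite mulr_ge0 // ltW.
  by apply: sumr_ge0 => k _; exact: sqr_ge0.
have nu : 0 < `|u| by rewrite normr_gt0.
rewrite -(ler_pM2r nu) (_ : lam * `|u| * `|u| = lam * `|u| ^+ 2); last ring.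
apply: le_trans (Hlam u) _; apply: le_trans (hess_coercive u) _.
rewrite {1}/u hessZ hess_sum -[leRHS]mulrA ler_wpM2l // mulrDl.
have -> : 4 * C * (\sum_(1 <= k < n.+1) `|F k| ^+ 2) * `|u| =
    \sum_(1 <= k < n.+1) 4 * C * `|F k| ^+ 2 * `|u|.
  by rewrite mulr_sumr mulr_suml.
apply: le_trans (_ : dot (\sum_(1 <= k < n.+1) Phi (m + F k)) u +
    \sum_(1 <= k < n.+1) 4 * C * `|F k| ^+ 2 * `|u| <= _); last first.
  by rewrite lerD2r (le_trans (ler_norm _)) // dot_le.
rewrite dot_suml -big_split /=; apply: ler_sum => k _.
by have := hess_taylor (F k) u; rewrite ler_norml => /andP[]; lra.
Qed.

End gradient.

(** Collects what the almost sure analysis uses about the objective; from here on, (A1), (A2) and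
    minimality act only through these properties. *)
Lemma median_gradient (R : realType) (H : completeNormedModType R)
    (dot : {dot H for idfun}) d (T : measurableType d) (P : probability T R)
    (X : {RV P >-> borel H}) (m : H) :
  induces_norm dot -> separable H -> assumption_A1 P dot X ->
  assumption_A2 P X -> geometric_median P X m ->
  exists (Phi : H -> H) (lam K : R),
  [/\ 0 < lam /\ 0 < K,
      forall h v, dot (Phi h) v = - \int[P]_t dot (direction ((X t : H) - h)) v,
      continuous Phi /\ (forall h, `|Phi h| <= 1),
      forall h, lam * `|h - m| ^+ 2 / (1 + `|h - m|) <= dot (Phi h) (h - m) &
      forall (F : nat -> H) n,
        lam * `|n%:R^-1 *: \sum_(1 <= k < n.+1) F k| <=
        n%:R^-1 * (`|\sum_(1 <= k < n.+1) Phi (m + F k)| +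
                   K * \sum_(1 <= k < n.+1) `|F k| ^+ 2)].
Proof.
move=> dn sH A1 [C C0 A2] med.
have [Phi PhiE] := gradient_exists dn sH X.
have [lam lam0 Hlam] := curvature_lower_bound dn sH m A1.
(* Halving [lam] absorbs the 2 in the denominator of [gradient_monotone]; the averaged bound holds
   with [lam], hence with half of it. *)
exists Phi, (lam / 2), (4 * C); split.
- by rewrite divr_gt0 // mulr_gt0.
- exact: PhiE.
- split; first exact: (gradient_continuous dn sH C0 A2 PhiE).
  exact: (gradient_le1 dn sH PhiE).
- move=> h; have := gradient_monotone dn sH C0 A2 med PhiE h Hlam.
  by rewrite invfM mulrA [_ / 2]mulrAC.
- move=> F n; apply: le_trans (average_le_gradient_average dn sH C0 A2 med PhiE F n Hlam).
  by rewrite ler_wpM2r // ler_pdivrMr // ler_peMr ?ltW // ltr1n.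
Qed.

(** * Independence of the past *)

Section independence.
Context d (T : measurableType d) (R : realType) (P : probability T R).
Local Open Scope ereal_scope.

Lemma independent_integral_eq0 d1 d2 (T1 : measurableType d1)
    (T2 : measurableType d2) (Y : {RV P >-> T1}) (W W' : {RV P >-> T2})
    (g : T1 * T2 -> R) (M : R) :
  (forall A B, measurable A -> measurable B ->
    P (Y @^-1` A `&` W @^-1` B) = P (Y @^-1` A) * P (W @^-1` B)) ->
  same_law W W' -> measurable_fun setT g -> (forall z, `|g z| <= M)%R ->
  (forall y, \int[P]_t g (y, W' t) = 0)%R ->
  (\int[P]_t g (Y t, W t) = 0)%R.
Proof.
move=> ind law mg bg g0.
have mYW : measurable_fun setT (fun t => (Y t, W t)).
  by apply/measurable_fun_pairP; split; exact: measurable_funPT.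
pose mYW' := isMeasurableFun.Build _ _ T (T1 * T2)%type _ mYW.
pose YW : {RV P >-> (T1 * T2)%type} := HB.pack (fun t => (Y t, W t)) mYW'.
have mgE : measurable_fun setT (EFin \o g) by exact/measurable_EFinP.
have prodE A : measurable A ->
    (distribution P Y \x distribution P W') A = distribution P YW A.
  apply: product_measure_unique => B C mB mC.
  rewrite /= -law // /distribution /pushforward /=.
  rewrite -ind //; congr (P _).
rewrite /Rintegral.
have int_comp : P.-integrable setT ((EFin \o g) \o YW).
  apply: (@bounded_integrable _ _ _ _ (g \o YW) M).
    exact: measurableT_comp.
  by move=> t; exact: bg.
transitivity (fine (\int[distribution P YW]_z (g z)%:E)).
  by rewrite integral_distribution.
rewrite -(@eq_measure_integral _ _ _ setT (distribution P YW)
  (distribution P Y \x distribution P W')); last by move=> A mA _; exact: prodE.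
rewrite -integral12_prod_meas1; last first.
  apply: (@measurable_bounded_integrable _ _ _ _ g) => //.
    have prodT := prodE _ measurableT; rewrite /= in prodT.
    by rewrite /= prodT ltey_eq (fin_num_measure (distribution P YW)).
  exists M; split; first exact: num_real.
  by move=> x Mx z _; exact: le_trans (bg z) (ltW Mx).
rewrite (eq_integral (cst 0)) ?integral0 // => y _.
have Iy : P.-integrable setT (EFin \o (fun t => g (y, W' t))).
  apply: (@bounded_integrable _ _ _ _ (fun t => g (y, W' t)) M) => //.
  apply: (measurableT_comp mg); apply/measurable_fun_pairP.
  by split; [exact: measurable_cst|exact: measurable_funPT].
rewrite /fubini_F integral_distribution //; last first.
  by apply: (measurableT_comp mgE); exact: pair1_measurable.
transitivity (\int[P]_t g (y, W' t))%R%:E; last by rewrite g0.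
by rewrite /Rintegral fineK //; exact: integrable_fin_num Iy.
Qed.

End independence.

(** * The sigma-algebras of the past *)

Section filtration.
Context d (T : measurableType d) (R : realType) (P : probability T R).
Context d' (T' : measurableType d') (Xs : nat -> {RV P >-> T'}).

(** A pi-system generating the sigma-algebra of the first [n] samples, in the shape of the events of
    [mutually_independent]. *)
Definition cylinder (n : nat) : set (set T) :=
  [set A | exists2 B : nat -> set T', (forall i, measurable (B i)) &
     A = \bigcap_(i in [set` [fset i in iota 1 n]%fset]) (Xs i @^-1` B i)].

(** The sample space with a coarser sigma-algebra: being adapted becomes ordinary measurability on
    this domain. *)
Definition past (n : nat) := g_sigma_algebraType (cylinder n).

Let in_index n i : (i \in [fset i in iota 1 n]%fset) = (1 <= i <= n)%N.
Proof. by rewrite inE mem_iota add1n ltnS. Qed.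

Lemma cylinderE n (B : nat -> set T') t :
  (\bigcap_(i in [set` [fset i in iota 1 n]%fset]) (Xs i @^-1` B i)) t <->
  forall i, (1 <= i <= n)%N -> B i (Xs i t).
Proof.
split=> [Bt i ni|Bt i]; first by apply: Bt; rewrite /= in_index.
by rewrite /= in_index; exact: Bt.
Qed.

Lemma cylinder_setI n : setI_closed (cylinder n).
Proof.
move=> _ _ [B mB ->] [C mC ->]; exists (fun i => B i `&` C i).
  by move=> i; exact: measurableI.
apply/seteqP; split=> t.
  by move=> [/cylinderE Bt /cylinderE Ct]; apply/cylinderE => i ni; split; auto.
move=> /cylinderE BCt; split; apply/cylinderE => i ni; first by case: (BCt i ni).
by case: (BCt i ni).
Qed.

Lemma cylinder_setT n : cylinder n setT.
Proof.
exists (fun=> setT) => //; exact/esym/seteqP.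
Qed.

Lemma measurable_cylinder n : cylinder n `<=` measurable.
Proof.
move=> _ [B mB ->]; apply: bigcap_measurableType => i _.
by rewrite -[_ @^-1` _]setTI; exact: measurable_funPT.
Qed.

Lemma past_measurable n (A : set T) : (cylinder n).-sigma.-measurable A ->
  measurable A.
Proof.
by apply: smallest_sub;
  [exact: sigma_algebra_measurable|exact: measurable_cylinder].
Qed.

Lemma pastS n (A : set T) : (cylinder n).-sigma.-measurable A ->
  (cylinder n.+1).-sigma.-measurable A.
Proof.
apply: smallest_sub; first exact: smallest_sigma_algebra.
move=> _ [B mB ->]; apply: sub_sigma_algebra.
exists (fun i => if i == n.+1 then setT else B i).
  by move=> i; case: ifP.
apply/seteqP; split=> t /cylinderE Bt; apply/cylinderE => i /andP[i1 ni].
  by case: eqP => // /eqP ni1; apply: Bt; rewrite i1 -ltnS ltn_neqAle ni1.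
have := Bt i; rewrite i1 (leqW ni) => /(_ isT).
by rewrite ltn_eqF.
Qed.

Lemma past_preimage n k (B : set T') : (1 <= k <= n)%N -> measurable B ->
  (cylinder n).-sigma.-measurable (Xs k @^-1` B).
Proof.
move=> kn mB; apply: sub_sigma_algebra.
exists (fun i => if i == k then B else setT); first by move=> i; case: ifP.
apply/seteqP; split=> t.
  by move=> Bt; apply/cylinderE => i _; case: eqP => // ->.
by move=> /cylinderE/(_ _ kn); rewrite eqxx.
Qed.

Hypothesis Xs_indep : mutually_independent [set n | (1 <= n)%N] Xs.
Local Open Scope ereal_scope.

(** Both sides are finite measures in [A]. They agree on the pi-system of cylinders, hence on the
    sigma-algebra it generates. *)
Lemma past_independent n (A : set T) (B : set T') :
  (cylinder n).-sigma.-measurable A -> measurable B ->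
  P (A `&` Xs n.+1 @^-1` B) = P A * P (Xs n.+1 @^-1` B).
Proof.
move=> pA mB; pose D : set T := Xs n.+1 @^-1` B.
have mD : measurable D by rewrite -[D]setTI; exact: measurable_funPT.
have PD0 : (0 <= fine (P D))%R by exact: fine_ge0.
have m1E E : mrestr P mD E = P (E `&` D) by [].
have m2E E : mscale (NngNum PD0) P E = P E * P D.
  by rewrite /mscale /= fineK ?fin_num_measure // muleC.
rewrite -m1E -m2E.
apply: (@g_sigma_algebra_measure_unique _ _ _ (cylinder n) _ (fun=> setT)) => //.
- exact: measurable_cylinder.
- by move=> _; exact: cylinder_setT.
- by rewrite bigcup_const.
- exact: cylinder_setI.
- move=> _ [C mC ->].
  apply: etrans (m1E _) _; apply: etrans _ (esym (m2E _)).
  (* Adding [B] as the constraint of index [n.+1] makes the intersection a single event of the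
     independence hypothesis. *)
  pose C' i := if i == n.+1 then B else C i.
  have mC' i : measurable (C' i) by rewrite /C'; case: ifP.
  have subJ k : [set` [fset i in iota 1 k]%fset] `<=` [set n | (1 <= n)%N].
    by move=> i /=; rewrite in_index => /andP[].
  have := Xs_indep (subJ n.+1) (fun i _ => mC' i).
  have -> : [fset i in iota 1 n.+1]%fset = (n.+1 |` [fset i in iota 1 n])%fset.
    apply/fsetP => i; rewrite in_index !inE /= mem_iota add1n ltnS.
    by rewrite (leq_eqVlt i) ltnS; case: eqP => [->|_].
  rewrite big_fsetU1 /=; last by rewrite in_index ltnn andbF.
  rewrite {2}/C' eqxx -/D => HC'.
  have EC : \prod_(i <- [fset i in iota 1 n]%fset) P (Xs i @^-1` C' i) =
     P (\bigcap_(i in [set` [fset i in iota 1 n]%fset]) (Xs i @^-1` C i)).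
    rewrite (Xs_indep (subJ n) (fun i _ => mC i)).
    rewrite big_seq [RHS]big_seq; apply: eq_bigr => i.
    by rewrite in_index /C' => /andP[_ ni]; rewrite ltn_eqF.
  rewrite EC muleC in HC'; rewrite -HC'; congr (P _); apply/seteqP; split=> t.
    move=> [/cylinderE Ct Dt] i /=; rewrite !inE /C'.
    case: eqP => [-> //|_]; rewrite /= mem_iota add1n ltnS => ni.
    exact: Ct.
  move=> HC; split; last first.
    have := HC n.+1; rewrite /= !inE eqxx /C' eqxx; exact.
  apply/cylinderE => i ni; have := HC i; rewrite /= !inE mem_iota add1n ltnS ni.
  by rewrite orbT /C' ltn_eqF //; [exact|case/andP: ni].
- by move=> _; rewrite ltey_eq fin_num_measure.
Qed.

End filtration.

(** * A maximal inequality *)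

Section expectation_indicator.
Context d (T : measurableType d) (R : realType) (P : probability T R).
Implicit Types (f g : T -> R).
Local Notation integ f := (P.-integrable setT (EFin \o f)).

Lemma integrable_indicM A f : measurable A -> integ f ->
  integ (fun t => \1_A t * f t).
Proof.
move=> mA If; have mf := Rintegrable_measurable If.
apply: le_integrable If => //.
  exact/measurable_EFinP/measurable_funM.
move=> t _; rewrite lee_fin normrM -[leRHS]mul1r ler_wpM2r //.
by rewrite indicE; case: (_ \in _); rewrite ?normr1 ?normr0.
Qed.

Lemma integrable_indicP A : measurable A -> integ (\1_A : T -> R).
Proof.
move=> mA; apply: (@bounded_integrable _ _ _ _ _ 1) => [|t];
  first exact: measurable_indic.
by rewrite indicE; case: (_ \in _); rewrite ?normr1 ?normr0.
Qed.

Lemma Rintegral_indicP A : measurable A -> \int[P]_t \1_A t = fine (P A).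
Proof. by move=> mA; rewrite /Rintegral integral_indic // setIT. Qed.

Lemma negligible_bigcap_small (U : nat -> set T) :
  (forall n, measurable (U n)) ->
  (forall e : R, 0 < e -> exists n, (P (U n) <= e%:E)%E) ->
  P.-negligible (\bigcap_n U n).
Proof.
move=> mU Usmall.
have mI : measurable (\bigcap_n U n) by exact: bigcap_measurableType.
exists (\bigcap_n U n); split=> //.
apply/eqP; rewrite eq_le measure_ge0 andbT; apply/lee_addgt0Pr => e e0.
have [n Hn] := Usmall e e0; rewrite add0e; apply: le_trans Hn.
by apply: le_measure; rewrite ?inE //; exact: bigcap_inf.
Qed.

End expectation_indicator.

Section maximal_inequality.
Context d (T : measurableType d) (R : realType) (P : probability T R).
Context (F : nat -> set (set T)).
Hypothesis F_setI : forall n A B, F n A -> F n B -> F n (A `&` B).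
Hypothesis F_S : forall n A, F n A -> F n.+1 A.
Hypothesis F_measurable : forall n A, F n A -> measurable A.
Context (V : nat -> T -> R) (B : nat -> R) (N0 : nat).
Hypothesis V_adapted : forall n L, (N0 <= n)%N -> F n [set w | V n w <= L].
Hypothesis V_integrable : forall n, (N0 <= n)%N ->
  P.-integrable setT (EFin \o V n).
Hypothesis V_ge0 : forall n w, 0 <= V n w.
Hypothesis B_ge0 : forall n, 0 <= B n.
(* [V n + B n] is a nonnegative supermartingale. *)
Hypothesis V_drift : forall n A, (N0 <= n)%N -> F n A ->
  \int[P]_w (\1_A w * V n.+1 w) <=
  \int[P]_w (\1_A w * V n w) + (B n - B n.+1).

Fixpoint stay_below (L : R) (N k : nat) : set T :=
  if k is k'.+1 then
    stay_below L N k' `&` [set w | V (N + k) w <= L]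
  else [set w | V N w <= L].

Lemma stay_below_F L N k : (N0 <= N)%N -> F (N + k) (stay_below L N k).
Proof.
move=> NN; elim: k => [|k IH] /=; first by rewrite addn0; exact: V_adapted.
apply: F_setI; first by rewrite addnS; exact: F_S.
by apply: V_adapted; rewrite (leq_trans NN) // leq_addr.
Qed.

Let stay_below_measurable L N k : (N0 <= N)%N -> measurable (stay_below L N k).
Proof. by move=> NN; apply: F_measurable; exact: stay_below_F. Qed.

Lemma stay_belowP L N k w : stay_below L N k w <->
  forall j, (j <= k)%N -> V (N + j) w <= L.
Proof.
elim: k => [|k IH] /=.
  split=> [H0 j|H0]; first by rewrite leqn0 => /eqP->; rewrite addn0.
  by have := H0 _ (leqnn 0); rewrite addn0.
split=> [[/IH H1 H2] j|H1].
  by rewrite leq_eqVlt => /orP[/eqP->//|]; rewrite ltnS; exact: H1.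
by split; [apply/IH => j jk; apply: H1; exact: leqW|exact: H1].
Qed.

(** Optional stopping at the first passage above [L]: paths that have left are counted with value
    [L], the others with their current value. *)
Lemma stay_below_expectation L N k : (N0 <= N)%N -> 0 <= L ->
  L * (1 - \int[P]_w \1_(stay_below L N k) w) +
  \int[P]_w (\1_(stay_below L N k) w * V (N + k) w) + B (N + k) <=
  \int[P]_w V N w + B N.
Proof.
move=> NN L0.
have NNk j : (N0 <= N + j)%N by rewrite (leq_trans NN) // leq_addr.
elim: k => [|k IH].
  rewrite addn0 lerD2r; set G := stay_below L N 0.
  have mG : measurable G by exact: stay_below_measurable.
  have IG : P.-integrable setT (EFin \o (\1_G : T -> R)).
    exact: integrable_indicP.
  have IV := V_integrable NN.
  have -> : L * (1 - \int[P]_w \1_G w) = \int[P]_w (L * (1 - \1_G w)).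
    have Ic : P.-integrable setT (EFin \o (fun=> 1 : R)).
      by apply: (@bounded_integrable _ _ _ _ _ 1) => // t; rewrite normr1.
    by rewrite RintegralZl ?RintegralB ?Rintegral_cstP //; exact: RintegrableB.
  have I2 : P.-integrable setT (EFin \o (fun w => L * (1 - \1_G w))).
    apply: RintegrableZ; apply: RintegrableB => //.
    by apply: (@bounded_integrable _ _ _ _ _ 1) => // t; rewrite normr1.
  have I3 := integrable_indicM mG IV.
  rewrite -RintegralD //; apply: le_Rintegral => //; first exact: RintegrableD.
  move=> w _; rewrite indicE; have [wG|wG] := boolP (w \in G).
    by rewrite subrr mulr0 add0r mul1r.
  rewrite subr0 mul0r mulr1 addr0 ltW //.
  rewrite real_ltNge ?num_real //; apply/negP => wL; move/negP: wG; apply.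
  by rewrite in_setE.
have FG : F (N + k) (stay_below L N k) by exact: stay_below_F.
have mG : measurable (stay_below L N k) by exact: stay_below_measurable.
have mG' : measurable (stay_below L N k.+1) by exact: stay_below_measurable.
have Vd := V_drift (NNk k) FG.
apply: le_trans IH; rewrite addnS.
set G := stay_below L N k in FG mG Vd *.
set G' := stay_below L N k.+1 in mG' *.
have IV := V_integrable (NNk k.+1); rewrite addnS in IV.
(* On the paths that leave at this step, [V] exceeds [L], so crediting them with [L] only lowers the
   total. *)
suff : L * (\int[P]_w \1_G w - \int[P]_w \1_G' w) +
    \int[P]_w (\1_G' w * V (N + k).+1 w) <=
    \int[P]_w (\1_G w * V (N + k).+1 w) by lra.
have IG := integrable_indicP P mG; have IG' := integrable_indicP P mG'.
have I3 := integrable_indicM mG IV; have I4 := integrable_indicM mG' IV.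
rewrite -RintegralB // -RintegralZl //; last exact: RintegrableB.
rewrite -RintegralD //; last exact/RintegrableZ/RintegrableB.
apply: le_Rintegral => //.
  by apply: RintegrableD => //; exact/RintegrableZ/RintegrableB.
move=> w _; rewrite !indicE; have [wG|wG] := boolP (w \in G); last first.
  have -> : (w \in G') = false.
    by apply: contraNF wG; rewrite !inE => -[].
  by rewrite subrr !mul0r mulr0 addr0.
have [wG'|wG'] := boolP (w \in G').
  by rewrite subrr mulr0 add0r.
rewrite subr0 mul0r mulr1 addr0 mul1r ltW //.
rewrite real_ltNge ?num_real //; apply/negP => wL; move/negP: wG'; apply.
by rewrite in_setE; split=> /=; [rewrite in_setE in wG|rewrite addnS].
Qed.

Lemma exceed_measurable L N : (N0 <= N)%N ->
  measurable (\bigcup_k ~` stay_below L N k).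
Proof.
move=> NN; apply: bigcupT_measurable => k; apply: measurableC.
exact: stay_below_measurable.
Qed.

(** Bounds the probability that [V] ever exceeds [L] from time [N] on, by letting the horizon of the
    stopped inequality tend to infinity. *)
Lemma maximal_inequality L N : (N0 <= N)%N -> 0 < L ->
  (P (\bigcup_k ~` stay_below L N k) <=
    ((\int[P]_w V N w + B N) / L)%:E)%E.
Proof.
move=> NN L0; have mC k : measurable (~` stay_below L N k).
  by apply: measurableC; exact: stay_below_measurable.
have cvgP : P (~` stay_below L N k) @[k --> \oo] -->
    P (\bigcup_k ~` stay_below L N k).
  apply: nondecreasing_cvg_mu => //; first exact: bigcupT_measurable.
  move=> i j ij; apply/subsetPset; apply: subsetC => w /stay_belowP wj.
  by apply/stay_belowP => l li; apply: wj; exact: leq_trans ij.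
rewrite -(cvg_lim _ cvgP) //; apply: lime_le.
  by apply/cvg_ex; eexists; exact: cvgP.
near=> k.
have mG : measurable (stay_below L N k) by exact: stay_below_measurable.
rewrite probability_setC // -[P _]fineK ?fin_num_measure //.
rewrite -Rintegral_indicP // lee_fin ler_pdivlMr // mulrC.
have := stay_below_expectation k NN (ltW L0).
have := B_ge0 (N + k).
have : 0 <= \int[P]_w (\1_(stay_below L N k) w * V (N + k) w).
  by apply: Rintegral_ge0 => w _; rewrite mulr_ge0 // indicE.
by lra.
Unshelve. all: by end_near.
Qed.

Lemma supermartingale_ae_bounded :
  {ae P, forall w, exists L, forall n, (N0 <= n)%N -> V n w <= L}.
Proof.
have : P.-negligible (\bigcap_j \bigcup_k ~` stay_below j.+1%:R N0 k).
  apply: negligible_bigcap_small.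
    by move=> j; exact: exceed_measurable.
  move=> e e0; set C := \int[P]_w V N0 w + B N0.
  have C0 : 0 <= C by rewrite addr_ge0 // Rintegral_ge0.
  exists (Num.truncn (C / e)); set j := Num.truncn _.
  apply: le_trans (maximal_inequality (leqnn N0) (ltr0Sn R j)) _.
  rewrite lee_fin ler_pdivrMr // mulrC -ler_pdivrMr //.
  exact/ltW/truncnS_gt.
apply: negligibleS => w /= nb j _; apply: contrapT => nk.
apply: nb; exists j.+1%:R => n Nn.
have /stay_belowP/(_ _ (leqnn _)) : stay_below j.+1%:R N0 (n - N0) w.
  by apply: contrapT => ns; apply: nk; exists (n - N0)%N.
by rewrite subnKC.
Qed.

(** Started at a late time, the maximal inequality has a small right side, so any fixed level is
    exceeded again only with small probability. *)
Lemma supermartingale_ae_cvg0 :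
  \int[P]_w V n w @[n --> \oo] --> 0 -> B n @[n --> \oo] --> 0 ->
  {ae P, forall w, V n w @[n --> \oo] --> 0}.
Proof.
move=> V0 B0.
have : P.-negligible (\bigcup_j \bigcap_i
    \bigcup_k ~` stay_below j.+1%:R^-1 (N0 + i) k).
  apply: negligible_bigcup => j; apply: negligible_bigcap_small.
    by move=> i; apply: exceed_measurable; rewrite leq_addr.
  move=> e e0; have VB0 : \int[P]_w V n w + B n @[n --> \oo] --> (0 : R).
    by rewrite -[X in _ --> X]addr0; exact: cvgD.
  have ej : 0 < e / j.+1%:R by rewrite divr_gt0.
  have [M _ HM] := (@cvgr0Pnorm_le _ _ _ _ _ _).1 VB0 _ ej.
  exists M; apply: le_trans (maximal_inequality _ _) _; rewrite ?leq_addr //.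
  rewrite lee_fin invrK -ler_pdivlMr //.
  by rewrite (le_trans (ler_norm _)) // HM //= leq_addl.
apply: negligibleS => w /= ncv; apply: contrapT => nw; apply: ncv.
apply/cvgr0Pnorm_le => e e0.
have [j _ Hj] := near_infty_natSinv_lt (PosNum e0).
apply: contrapT => He; apply: nw; exists j => // i _.
apply: contrapT => nk; apply: He.
exists (N0 + i)%N => // n /= Nn; rewrite ger0_norm //.
have /stay_belowP/(_ _ (leqnn _)) :
    stay_below j.+1%:R^-1 (N0 + i) (n - (N0 + i)) w.
  by apply: contrapT => ns; apply: nk; exists (n - (N0 + i))%N.
rewrite subnKC // => /le_trans; apply; apply: ltW; exact: Hj (leqnn j).
Qed.

End maximal_inequality.

(** * Deterministic estimates *)

Section power_estimates.
Context (R : realType).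
Implicit Types (x y z p q : R) (n : nat).

(** The tangent at 1 of a convex function, from ln t <= t - 1 and exp x >= 1 + x. *)
Let powRN_ge t q : 0 < t <= 1 -> 0 <= q -> 1 + q * (1 - t) <= t `^ (- q).
Proof.
move=> /andP[t0 t1] q0; rewrite /powR gt_eqF //.
apply: le_trans (expR_ge1Dx _); rewrite lerD2l mulNr -mulrN ler_wpM2l //.
have := @le_ln1Dx R (t - 1); rewrite [1 + _]addrC subrK => H.
by rewrite lerNr opprB H // ltrBrDr addNr.
Qed.

Lemma powRN_diff_ge q y z : 0 < q -> 0 < y -> y <= z ->
  q * z `^ (- (1 + q)) * (z - y) <= y `^ (- q) - z `^ (- q).
Proof.
move=> q0 y0 yz; have z0 : 0 < z by exact: lt_le_trans yz.
have t01 : 0 < y / z <= 1 by rewrite divr_gt0 //= ler_pdivrMr // mul1r.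
have H := powRN_ge t01 (ltW q0).
have -> : y `^ (- q) = z `^ (- q) * (y / z) `^ (- q).
  by rewrite -powRM ?divr_ge0 ?ltW // [z * _]mulrC divfK ?gt_eqF.
rewrite lerBrDr; apply: le_trans (ler_wpM2l (powR_ge0 _ _) H).
have -> : z `^ (- (1 + q)) = z^-1 * z `^ (- q).
  by rewrite opprD powRD ?powR_inv1 ?(ltW z0) // (gt_eqF z0) implybT.
by rewrite le_eqVlt; apply/orP; left; apply/eqP; field; rewrite gt_eqF.
Qed.

(** With h = q (1 - y / z) in [0, 1], the tangent bound gives (y / z)^q <= 1 / (1 + h); the factor
    1/2 comes from 1 - 1 / (1 + h) >= h / 2. *)
Lemma powR_diff_ge q y z : 0 < q <= 1 -> 0 <= y -> y < z ->
  q / 2 * z `^ (q - 1) * (z - y) <= z `^ q - y `^ q.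
Proof.
move=> /andP[q0 q1]; rewrite le_eqVlt => /orP[/eqP<-|y0] yz.
  rewrite powR0 ?gt_eqF // !subr0 -[leLHS]mulrA [X in _ * X]mulrC.
  rewrite mulr_powRB1 ?(ltW yz) //.
  by rewrite ler_piMl ?powR_ge0 // ler_pdivrMr // mul1r (le_trans q1) // ler1n.
have z0 : 0 < z by exact: lt_trans yz.
have t01 : 0 < y / z <= 1 by rewrite divr_gt0 //= ler_pdivrMr // mul1r ltW.
have := powRN_ge t01 (ltW q0); rewrite powRN.
have tp : 0 < (y / z) `^ q by apply: powR_gt0; case/andP: t01.
have yE : y `^ q = z `^ q * (y / z) `^ q.
  by rewrite -powRM ?divr_ge0 ?ltW // [z * _]mulrC divfK ?gt_eqF.
have -> : z `^ (q - 1) = z `^ q / z.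
  by rewrite powRD ?powR_inv1 ?(ltW z0) // (gt_eqF z0) implybT.
have -> : q / 2 * (z `^ q / z) * (z - y) = z `^ q * (q / 2 * (1 - y / z)).
  by field; rewrite gt_eqF.
have -> : z `^ q - y `^ q = z `^ q * (1 - (y / z) `^ q) by rewrite yE; ring.
move=> H; rewrite ler_wpM2l ?powR_ge0 //.
have H1 : (1 + q * (1 - y / z)) * (y / z) `^ q <= 1.
  by rewrite -ler_pdivlMr // div1r.
move: H1 tp t01; clear H yE; move: (y / z) ((y / z) `^ q) => t r H ? /andP[t0 t1].
have h0 : 0 <= q * (1 - t) by rewrite mulr_ge0 ?(ltW q0) // subr_ge0.
have h1 : q * (1 - t) <= 1.
  by rewrite mulr_ile1 ?(ltW q0) ?subr_ge0 // gerBl ltW.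
have -> : q / 2 * (1 - t) = q * (1 - t) / 2 by rewrite mulrAC.
by move: (q * (1 - t)) h0 h1 H => h ? ? ?; nra.
Qed.

(** A telescoping integral test: n^(- q) / q dominates the tail of the series of k^(- (1 + q)), and
    so serves as a potential. *)
Lemma natr_powRN_diff_ge q n : 0 < q -> (1 <= n)%N ->
  q * n.+1%:R `^ (- (1 + q)) <= n%:R `^ (- q) - n.+1%:R `^ (- q).
Proof.
move=> q0 n1; have n0 : 0 < n%:R :> R by rewrite ltr0n.
have := @powRN_diff_ge q n%:R n.+1%:R q0 n0; rewrite ler_nat => /(_ (leqnSn n)).
by rewrite -natrB // subSnn mulr1.
Qed.

Lemma ln_natS_diff n : (1 <= n)%N -> n.+1%:R^-1 <= ln n.+1%:R - ln n%:R :> R.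
Proof.
move=> n1; have n0 : 0 < n%:R :> R by rewrite ltr0n.
rewrite -lerN2 opprB -ln_div ?posrE //.
have -> : n%:R / n.+1%:R = 1 + - n.+1%:R^-1 :> R.
  by rewrite -natr1; field; rewrite natr1 pnatr_eq0.
by apply: le_ln1Dx; rewrite ltrN2 invf_lt1 // ltr1n.
Qed.

(** The same for the series of 1 / (k (ln k)^(1 + q)). It starts at 2 because ln 1 = 0. *)
Lemma ln_powRN_diff_ge q n : 0 < q -> (2 <= n)%N ->
  q * (n.+1%:R^-1 * ln n.+1%:R `^ (- (1 + q))) <=
  ln n%:R `^ (- q) - ln n.+1%:R `^ (- q) :> R.
Proof.
move=> q0 n2; have ln0 : 0 < ln n%:R :> R by rewrite ln_gt0 // ltr1n.
have n1 : (1 <= n)%N by exact: leq_trans n2.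
have lnS : ln n%:R <= ln n.+1%:R :> R.
  by rewrite ler_ln ?posrE ?ltr0n // ler_nat.
apply: le_trans (powRN_diff_ge q0 ln0 lnS).
rewrite -[leRHS]mulrA (ler_pM2l q0) mulrC ler_wpM2l ?powR_ge0 //.
exact: ln_natS_diff.
Qed.

Lemma sum_powRN_le p n : 0 < p < 1 ->
  \sum_(1 <= k < n.+1) k%:R `^ (- p) <= 2 / (1 - p) * n%:R `^ (1 - p) :> R.
Proof.
move=> /andP[p0 p1]; have s0 : 0 < 1 - p by rewrite subr_gt0.
elim: n => [|n IH].
  by rewrite big_geq // mulr_ge0 ?powR_ge0 // divr_ge0 // ltW.
rewrite big_nat_recr //=; apply: le_trans (lerD IH (lexx _)) _.
rewrite -lerBrDl -mulrBr [leRHS]mulrC mulrA ler_pdivlMr // [leLHS]mulrC.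
have := @powR_diff_ge (1 - p) n%:R n.+1%:R; rewrite s0 gerBl (ltW p0) => /(_ isT).
rewrite ltr_nat ltnSn ler0n => /(_ isT isT).
rewrite -natrB // subSnn mulr1 [1 - p - 1]addrC addrA addNr add0r.
by rewrite [_ / 2 * _]mulrAC ler_pdivrMr //;apply.
Qed.

Lemma natS_powR_le p n : 0 <= p <= 2 -> (1 <= n)%N ->
  n.+1%:R `^ p <= 4 * n%:R `^ p :> R.
Proof.
move=> /andP[p0 p2] n1.
apply: (@le_trans _ _ ((2 * n%:R) `^ p)).
  apply: ge0_ler_powR; rewrite ?nnegrE ?mulr_ge0 //.
  by rewrite -natrM ler_nat mul2n -addnn -[n.+1]add1n leq_add2r.
rewrite powRM // ler_wpM2r ?powR_ge0 //.
apply: (@le_trans _ _ (2 `^ 2)); first by apply: ler_powR => //; rewrite ler1n.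
by rewrite (powR_mulrn 2) // -natrX.
Qed.

Lemma powRN_le q e y : 0 < q -> 0 < e -> e `^ (- q^-1) <= y -> y `^ (- q) <= e.
Proof.
move=> q0 e0 ey; have e1 : 0 < e `^ (- q^-1) by exact: powR_gt0.
have y0 : 0 < y by exact: lt_le_trans ey.
rewrite powRN -[leRHS]invrK lef_pV2 ?posrE ?invr_gt0 ?powR_gt0 //.
apply: le_trans (_ : (e `^ (- q^-1)) `^ q <= _).
  by rewrite -powRrM mulNr mulVf ?gt_eqF // powR_inv1 // ltW.
by apply: ge0_ler_powR; rewrite ?nnegrE ?(ltW q0) ?(ltW e1) ?(ltW y0).
Qed.

Lemma natr_large y : \forall n \near \oo, y <= n%:R.
Proof.
exists (Num.truncn y).+1 => // n /= yn.
by apply: le_trans (ltW (truncnS_gt _)) _; rewrite ler_nat.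
Qed.

Lemma ln_natr_large y : \forall n \near \oo, y <= ln n%:R.
Proof.
apply: filterS (natr_large (expR y)) => n yn.
by rewrite -[y]expRK ler_ln ?posrE ?expR_gt0 // (lt_le_trans _ yn) // expR_gt0.
Qed.

Lemma natr_powR_large q y : 0 < q -> \forall n \near \oo, y <= n%:R `^ q.
Proof.
move=> q0; pose z := Num.max y 1; have z0 : 0 < z by rewrite lt_max ltr01 orbT.
apply: filterS (natr_large ((z^-1) `^ (- q^-1))) => n yn.
have := powRN_le q0 _ yn; rewrite invr_gt0 => /(_ z0); rewrite powRN => H.
have n0 : 0 < n%:R `^ q.
  apply: powR_gt0; apply: lt_le_trans yn; apply: powR_gt0; by rewrite invr_gt0.
move: H; rewrite lef_pV2 ?posrE // => zn; apply: le_trans zn.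
by rewrite le_max lexx.
Qed.

Lemma cvg_powRN (u : nat -> R) q : 0 < q ->
  (forall y, \forall n \near \oo, y <= u n) ->
  u n `^ (- q) @[n --> \oo] --> 0.
Proof.
move=> q0 ularge; apply/cvgr0Pnorm_le => e e0.
apply: filterS (ularge (e `^ (- q^-1))) => n un.
by rewrite ger0_norm ?powR_ge0 // powRN_le.
Qed.

Lemma natr_powR_diff_le q n : 0 <= q <= 1 -> (1 <= n)%N ->
  n.+1%:R `^ q - n%:R `^ q <= n.+1%:R `^ (q - 1) :> R.
Proof.
move=> /andP[q0 q1] n1; have n0 : 0 < n%:R :> R by rewrite ltr0n.
have t01 : 0 < (n%:R / n.+1%:R : R) <= 1.
  by rewrite divr_gt0 //= ler_pdivrMr // mul1r ler_nat.
have H := ger1_powR t01 q1.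
have -> : n%:R `^ q = n.+1%:R `^ q * (n%:R / n.+1%:R) `^ q :> R.
  by rewrite -powRM ?divr_ge0 // [_.+1%:R * _]mulrC divfK.
rewrite powRD ?powR_inv1 ?pnatr_eq0 ?implybT //.
rewrite -{1}[_ `^ q]mulr1 -mulrBr ler_wpM2l ?powR_ge0 //; apply: le_trans (lerB (lexx 1) H) _.
by rewrite -natr1 le_eqVlt; apply/orP; left; apply/eqP; field; rewrite natr1 pnatr_eq0.
Qed.

Lemma natS_powRN_ge q n : 0 <= q <= 1 -> (1 <= n)%N ->
  n%:R `^ (- q) * (1 - n%:R^-1) <= n.+1%:R `^ (- q) :> R.
Proof.
move=> /andP[q0 q1] n1; have n0 : 0 < n%:R :> R by rewrite ltr0n.
have t01 : 0 < (n%:R / n.+1%:R : R) <= 1.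
  by rewrite divr_gt0 //= ler_pdivrMr // mul1r ler_nat.
have H := ger1_powR t01 q1.
have -> : n.+1%:R `^ (- q) = n%:R `^ (- q) * (n%:R / n.+1%:R) `^ q :> R.
  rewrite powRM ?invr_ge0 // mulrA -powRD ?(gt_eqF n0) ?implybT // addNr powRr0 mul1r.
  by rewrite powRN -!powR_inv1 // -!powRrM mulN1r mulrN1.
rewrite ler_wpM2l ?powR_ge0 // (le_trans _ H) // ler_pdivlMr // -natr1.
by rewrite mulrDr mulr1 mulrBl mul1r mulVf ?gt_eqF // -addrA gerDl addrC subr_le0 gerBl invr_ge0.
Qed.

(** For a < 1 the relative decrease of n^(- a) in one step is at most 1 / n, eventually below half
    of the contraction; the other half pays for the squared step. *)
Lemma robbins_monro_rate (a c kappa E0 : R) (e : nat -> R) :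
  0 < a < 1 -> 0 < c -> 0 < kappa -> 0 <= E0 ->
  (forall n, (1 <= n)%N -> e n <= E0) ->
  (forall n, (1 <= n)%N -> e n.+1 <=
     (1 - kappa * (c * n%:R `^ (- a))) * e n + (c * n%:R `^ (- a)) ^+ 2) ->
  exists2 K : R, 0 <= K & forall n, (1 <= n)%N -> e n <= K * n%:R `^ (- a).
Proof.
move=> /andP[a0 a1] c0 k0 E00 eE0 rec.
have kc0 : 0 < kappa * c by rewrite mulr_gt0.
have a10 : 0 < 1 - a by rewrite subr_gt0.
(* [N1] makes 1 / n at most half of the contraction; [N2] keeps the factor 1 - kappa c n^(- a)
   nonnegative, so that the induction hypothesis can be multiplied by it. *)
have [N1 _ HN1] := natr_powR_large (2 / (kappa * c)) a10.
have [N2 _ HN2] := natr_powR_large (kappa * c) a0.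
pose N := (maxn N1 N2).+1.
(* The first term pays for the squared step in the induction; the second makes the claim follow from
   the bound [E0] up to [N]. *)
pose K := Num.max (2 * c / kappa) (E0 * N%:R `^ a).
have KE : E0 * N%:R `^ a <= K by rewrite le_max lexx orbT.
have Kc : 2 * c / kappa <= K by rewrite le_max lexx.
have K0 : 0 <= K by apply: le_trans Kc; rewrite divr_ge0 ?mulr_ge0 // ltW.
exists K => //.
have small n : (1 <= n <= N)%N -> e n <= K * n%:R `^ (- a).
  move=> /andP[n1 nN]; have n0 : 0 < n%:R :> R by rewrite ltr0n.
  rewrite (le_trans (eE0 n n1)) // powRN ler_pdivlMr ?powR_gt0 //.
  rewrite (le_trans _ KE) // ler_wpM2l //.
  by apply: ge0_ler_powR; rewrite ?nnegrE ?(ltW a0) ?ler_nat.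
suff large n : (N <= n)%N -> e n <= K * n%:R `^ (- a).
  move=> n n1; have [nN|Nn] := leqP n N; first by apply: small; rewrite n1.
  exact/large/ltnW.
elim: n => [//|n IH]; rewrite leq_eqVlt => /orP[/eqP<-|].
  by apply: small; rewrite leqnn.
rewrite ltnS => Nn; have n1 : (1 <= n)%N by exact: leq_trans Nn.
have n0 : 0 < n%:R :> R by rewrite ltr0n.
have {}IH := IH Nn; apply: le_trans (rec n n1) _.
have P1 : 2 / (kappa * c) <= n%:R `^ (1 - a).
  by apply: HN1; apply: leq_trans Nn; rewrite leqW // leq_maxl.
have P2 : kappa * c <= n%:R `^ a.
  by apply: HN2; apply: leq_trans Nn; rewrite leqW // leq_maxr.
have a01 : 0 <= a <= 1 by rewrite !ltW.
have P3 := natS_powRN_ge a01 n1.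
set g := n%:R `^ (- a) in IH P3 *; set g' := _.+1%:R `^ _ in P3 *.
have g0 : 0 < g by exact: powR_gt0.
have P1' : n%:R^-1 <= kappa * c * g / 2.
  rewrite -(ler_pM2r n0) mulVf ?gt_eqF //.
  have -> : kappa * c * g / 2 * n%:R = kappa * c / 2 * n%:R `^ (1 - a).
    by rewrite powRD ?powRr1 ?(gt_eqF n0) ?implybT // -/g; ring.
  by rewrite -ler_pdivrMl ?divr_gt0 // mulr1 invf_div.
have P2' : kappa * c * g <= 1.
  by rewrite /g powRN ler_pdivrMr ?powR_gt0 // mul1r.
have Q1 : (1 - kappa * (c * g)) * e n <= (1 - kappa * (c * g)) * (K * g).
  by rewrite ler_wpM2l // subr_ge0 mulrA.
have Q2 : K * g * (1 - kappa * c * g / 2) <= K * g'.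
  rewrite -mulrA ler_wpM2l // (le_trans _ P3) // ler_wpM2l ?(ltW g0) //.
  by rewrite lerB.
have Q3 : (c * g) ^+ 2 <= K * kappa / 2 * c * g ^+ 2.
  rewrite exprMn ler_wpM2r ?sqr_ge0 // expr2 ler_wpM2r ?(ltW c0) //.
  by move: Kc; rewrite ler_pdivrMr // ler_pdivlMr // [2 * c]mulrC.
nra.
Qed.

End power_estimates.

(** * The stochastic gradient sequence *)

Lemma borel_measurable_precomp d d' (T : measurableType d)
    (T' : measurableType d') (Y : topologicalType) (f : T' -> Y)
    (phi : T -> T') : measurable_fun setT phi -> borel_measurable f ->
  borel_measurable (f \o phi).
Proof.
move=> mphi mf U oU; rewrite comp_preimage -[_ @^-1` _]setTI.
by apply: mphi => //; exact: mf.
Qed.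

Section stochastic_gradient_increments.
Context (R : realType) (H : completeNormedModType R).
Context (dot : {dot H for idfun}) (dot_norm : induces_norm dot).
Context (H_separable : separable H).
Context d (T : measurableType d) (P : probability T R).
Context (X : {RV P >-> borel H}) (m : H) (alpha c : R) (c_gt0 : 0 < c).
Context (Xs : nat -> {RV P >-> borel H}).
Hypothesis Xs_law : forall n, (1 <= n)%N -> same_law (Xs n) X.
Hypothesis Xs_indep : mutually_independent [set n | (1 <= n)%N] Xs.
Context (Z : nat -> T -> H).
Hypothesis Z1_measurable : forall A : set (borel H), measurable A ->
  g_sigma_algebra_preimage (Xs 1%N) (Z 1%N @^-1` A).
Hypothesis Z1_bounded : exists M : R, forall w, `|Z 1%N w| <= M.
Hypothesis Z_sgd : stochastic_gradient c alpha Xs Z.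
Context (Phi : H -> H).
Hypothesis PhiE : forall h v,
  dot (Phi h) v = - \int[P]_t dot (direction ((X t : H) - h)) v.
Hypothesis Phi_continuous : continuous Phi.
Hypothesis Phi_le1 : forall h, `|Phi h| <= 1.

Local Notation F n := (cylinder Xs n).-sigma.-measurable.
Local Notation adapted n f := (borel_measurable (f : past Xs n -> _)).
Local Notation integ f := (P.-integrable setT (EFin \o f)).

Definition step_size n : R := c * n%:R `^ (- alpha).

(* the martingale increment of index [n.+1] *)
Definition noise n w : H := direction ((Xs n.+1 w : H) - Z n w) + Phi (Z n w).

Lemma step_size_ge0 n : 0 <= step_size n.
Proof. by rewrite mulr_ge0 ?powR_ge0 // ltW. Qed.

Lemma adaptedS n (Y : topologicalType) (f : T -> Y) :
  adapted n f -> adapted n.+1 f.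
Proof. by move=> mf U oU; apply: pastS; exact: mf. Qed.

Lemma Xs_adapted k n : (1 <= k <= n)%N -> adapted n (Xs k : T -> H).
Proof.
by move=> kn U oU; apply: past_preimage => //; exact: sub_sigma_algebra.
Qed.

Lemma sgdS n w : (1 <= n)%N ->
  Z n.+1 w = Z n w + step_size n *: direction ((Xs n.+1 w : H) - Z n w).
Proof. by move=> n1; rewrite Z_sgd. Qed.

Lemma Z_adapted n : (1 <= n)%N -> adapted n (Z n).
Proof.
elim: n => [//|[_ _|n IH _]].
  move=> U oU; have mU : measurable (U : set (borel H)) by exact: sub_sigma_algebra.
  have [B mB] := Z1_measurable mU; rewrite setTI => <-.
  exact: past_preimage.
have mZ : adapted n.+2 (Z n.+1) by apply: adaptedS; exact: IH.
rewrite (_ : Z n.+2 = fun w => Z n.+1 w + step_size n.+1 *: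
   direction ((Xs n.+2 w : H) - Z n.+1 w)); last first.
  by apply/funext => w; rewrite sgdS.
apply: borel_measurable_add => //; apply: borel_measurable_scale => //.
apply: borel_measurable_direction => //; apply: borel_measurable_sub => //.
by apply: Xs_adapted; rewrite leqnn.
Qed.

(** The bound grows with [n] and serves integrability; a bound uniform in [n] is only almost sure,
    see [err_ae_bounded]. *)
Lemma Z_bounded n : (1 <= n)%N -> exists M, forall w, `|Z n w| <= M.
Proof.
elim: n => [//|[_ _|n IH _]]; first exact: Z1_bounded.
have [M HM] := IH isT; exists (M + step_size n.+1) => w.
rewrite sgdS // (le_trans (ler_normD _ _)) // lerD // normrZ.
rewrite ger0_norm ?step_size_ge0 // ler_piMr ?step_size_ge0 //.
exact: norm_direction_le1.
Qed.

Lemma Phi_adapted n : (1 <= n)%N -> adapted n (fun w => Phi (Z n w)).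
Proof.
by move=> n1; apply: (borel_measurable_comp Phi_continuous); exact: Z_adapted.
Qed.

Lemma noise_adapted n : (1 <= n)%N -> adapted n.+1 (noise n).
Proof.
move=> n1; apply: borel_measurable_add => //; last first.
  by apply: adaptedS; exact: Phi_adapted.
apply: borel_measurable_direction => //; apply: borel_measurable_sub => //.
  by apply: Xs_adapted; rewrite leqnn.
by apply: adaptedS; exact: Z_adapted.
Qed.

Lemma noise_le2 n w : `|noise n w| <= 2.
Proof.
rewrite (le_trans (ler_normD _ _)) // (_ : 2 = 1 + 1) // lerD //.
exact: norm_direction_le1.
Qed.

(** The noise has conditional mean 0 given the past: with the past frozen, [PhiE] cancels the mean
    of the direction. It is used with the error and with the martingale as [Y]. *)
Lemma noise_orthogonal n A (Y : T -> H) (M : R) : (1 <= n)%N -> F n A ->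
  adapted n Y -> (forall w, `|Y w| <= M) ->
  \int[P]_w (\1_A w * dot (noise n w) (Y w)) = 0.
Proof.
move=> n1 FA aY bY.
(* The whole past is treated as one random variable, the identity into the coarser space. *)
have mid : measurable_fun setT (idfun : T -> past Xs n).
  by move=> _ B FB; rewrite setTI; exact: past_measurable FB.
pose mid' := isMeasurableFun.Build _ _ T (past Xs n) _ mid.
pose Id : {RV P >-> past Xs n} := HB.pack (idfun : T -> past Xs n) mid'.
pose g (z : past Xs n * borel H) : R := \1_A z.1 *
  dot (direction ((z.2 : H) - Z n z.1) + Phi (Z n z.1)) (Y z.1).
apply: (@independent_integral_eq0 _ _ _ P _ _ _ _ Id (Xs n.+1) X g (2 * M)).
- by move=> B C FB mC; exact: past_independent.
- exact: Xs_law.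
- have mfst f : adapted n f ->
      borel_measurable (fun z : past Xs n * borel H => f z.1 : H).
    by apply: borel_measurable_precomp; exact: measurable_fst.
  apply: measurable_funM.
    apply: (measurableT_comp (f := \1_A : past Xs n -> R)).
      exact: measurable_indic.
    exact: measurable_fst.
  apply: measurable_dot => //; last exact: mfst.
  apply: borel_measurable_add => //; last exact: (mfst _ (Phi_adapted n1)).
  apply: borel_measurable_direction => //; apply: borel_measurable_sub => //.
    by apply/borel_measurableP; exact: measurable_snd.
  exact: (mfst _ (Z_adapted n1)).
- move=> z; rewrite normrM -[leRHS]mul1r ler_pM //.
    by rewrite indicE; case: (_ \in _); rewrite ?normr1 ?normr0.
  apply: ler_dot => //; rewrite (le_trans (ler_normD _ _)) //.
  by rewrite (_ : 2 = 1 + 1) // lerD //; exact: norm_direction_le1.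
- move=> y; rewrite /g /=.
  have Id' := integrable_dir_dot dot_norm H_separable X (Z n y) (Y y).
  rewrite RintegralZl //; last first.
    under eq_fun do rewrite dotDl.
    apply: RintegrableD => //.
    exact: (@bounded_integrable _ _ _ _ _ `|dot (Phi (Z n y)) (Y y)|).
  under eq_Rintegral do rewrite dotDl.
  rewrite RintegralD //; last first.
    exact: (@bounded_integrable _ _ _ _ _ `|dot (Phi (Z n y)) (Y y)|).
  by rewrite Rintegral_cstP PhiE subrr mulr0.
Qed.

Local Notation err n w := (Z n w - m).

Lemma err_adapted n : (1 <= n)%N -> adapted n (fun w => err n w).
Proof.
move=> n1; apply: borel_measurable_sub => //; first exact: Z_adapted.
exact: borel_measurable_cst.
Qed.

Lemma err_bounded n : (1 <= n)%N -> exists M, forall w, `|err n w| <= M.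
Proof.
move=> /Z_bounded[M HM]; exists (M + `|m|) => w.
by rewrite (le_trans (ler_normB _ _)) // lerD2r.
Qed.

Lemma past_measurable_fun n (f : T -> R) :
  measurable_fun setT (f : past Xs n -> R) -> measurable_fun setT f.
Proof.
move=> mf _ B mB; apply: (@past_measurable _ _ _ _ _ _ Xs n).
exact: (mf measurableT B mB).
Qed.

Lemma past_sublevel n (f : T -> R) L :
  measurable_fun setT (f : past Xs n -> R) -> F n [set w | f w <= L].
Proof.
move=> mf; rewrite (_ : [set w | f w <= L] = setT `&` f @^-1` `]-oo, L]).
  by apply: mf => //; exact: measurable_itv.
by rewrite setTI; apply/seteqP; split=> w /=; rewrite in_itv.
Qed.

Lemma past_setI n A B : F n A -> F n B -> F n (A `&` B).
Proof. exact: (@measurableI _ (past Xs n)). Qed.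

Lemma integrable_bounded (f : T -> R) : measurable_fun setT f ->
  (exists M, forall w, `|f w| <= M) -> integ f.
Proof. by move=> mf [M HM]; exact: bounded_integrable HM. Qed.

Definition sqerr n w : R := `|err n w| ^+ 2.

Lemma sqerr_ge0 n w : 0 <= sqerr n w.
Proof. exact: sqr_ge0. Qed.

Lemma sqerr_adapted n : (1 <= n)%N ->
  measurable_fun setT (sqerr n : past Xs n -> R).
Proof.
by move=> n1; apply: measurable_funX; apply: measurable_norm; exact: err_adapted.
Qed.

Lemma sqerr_integrable n : (1 <= n)%N -> integ (sqerr n).
Proof.
move=> n1; apply: integrable_bounded.
  exact: past_measurable_fun (sqerr_adapted n1).
have [M HM] := err_bounded n1; exists (M ^+ 2) => w.
by rewrite ger0_norm ?sqerr_ge0 // lerXn2r ?nnegrE // (le_trans _ (HM w)).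
Qed.

Let drift n w : R := dot (Phi (Z n w)) (err n w).

Lemma drift_integrable n : (1 <= n)%N -> integ (drift n).
Proof.
move=> n1; apply: integrable_bounded.
  apply: (@past_measurable_fun n); apply: measurable_dot => //.
    exact: (Phi_adapted n1).
  exact: (err_adapted n1).
by have [M HM] := err_bounded n1; exists (1 * M) => w; exact: ler_dot.
Qed.

Lemma sqerr_step n A : (1 <= n)%N -> F n A ->
  \int[P]_w (\1_A w * sqerr n.+1 w) <=
  \int[P]_w (\1_A w * (sqerr n w - 2 * step_size n * drift n w)) +
  step_size n ^+ 2.
Proof.
move=> n1 FA; have mA := past_measurable FA.
have [M HM] := err_bounded n1.
have ortho := noise_orthogonal n1 FA (err_adapted n1) HM.
have g0 := step_size_ge0 n.
have I1 : integ (fun w => \1_A w * (sqerr n w - 2 * step_size n * drift n w)).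
  apply: integrable_indicM => //; apply: RintegrableB.
    exact: sqerr_integrable.
  exact/RintegrableZ/drift_integrable.
have I2 : integ (fun w => \1_A w * dot (noise n w) (err n w)).
  apply: integrable_indicM => //; apply: integrable_bounded.
    apply: (@past_measurable_fun n.+1); apply: measurable_dot => //.
      exact: (noise_adapted n1).
    exact: (adaptedS (err_adapted n1)).
  by exists (2 * M) => w; apply: ler_dot => //; exact: noise_le2.
have Ic : integ (fun=> step_size n ^+ 2).
  exact: (@bounded_integrable _ _ _ _ _ `|step_size n ^+ 2|).
(* Adding the noise integral, which is 0, reduces the claim to a pointwise expansion of the
   square. *)
have -> : \int[P]_w (\1_A w * (sqerr n w - 2 * step_size n * drift n w)) +
    step_size n ^+ 2 = \int[P]_w
   ((\1_A w * (sqerr n w - 2 * step_size n * drift n w) +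
     2 * step_size n * (\1_A w * dot (noise n w) (err n w))) + step_size n ^+ 2).
  rewrite RintegralD ?Rintegral_cstP //; last first.
    by apply: RintegrableD => //; exact: RintegrableZ.
  rewrite RintegralD //; last exact: RintegrableZ.
  by rewrite RintegralZl // ortho mulr0 addr0.
apply: le_Rintegral => //.
- by apply: integrable_indicM => //; exact: sqerr_integrable.
- by apply: RintegrableD => //; apply: RintegrableD => //; exact: RintegrableZ.
move=> w _; rewrite indicE; case: (w \in A); last first.
  by rewrite !mul0r mulr0 !add0r sqr_ge0.
rewrite !mul1r /sqerr sgdS // [_ + _ - m]addrAC (normDsq dot_norm) dotZr normrZ.
rewrite exprMn real_normK ?num_real // /drift /noise (dotDl dot (direction _)).
have U1 : `|direction ((Xs n.+1 w : H) - Z n w)| ^+ 2 <= 1.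
  by rewrite expr_le1 // norm_direction_le1.
rewrite (dotC dot _ (direction _)) -subr_ge0.
move: (dot (direction _) _) (dot (Phi _) _) (`|err n w| ^+ 2) => x y z.
move: (`|_| ^+ 2) U1 (step_size n) => u u1 s.
rewrite (_ : _ - _ = s ^+ 2 * (1 - u)); last by ring.
by rewrite mulr_ge0 ?sqr_ge0 // subr_ge0.
Qed.

(** * Almost sure boundedness and truncation of the error *)

Hypotheses (alpha_gt : 1 / 2 < alpha) (alpha_lt : alpha < 1).
Context (lam : R) (lam_gt0 : 0 < lam).
Hypothesis Phi_monotone : forall h,
  lam * `|h - m| ^+ 2 / (1 + `|h - m|) <= dot (Phi h) (h - m).

Let a21 : 0 < 2 * alpha - 1.
Proof. by move: alpha_gt; rewrite ltr_pdivrMr // mulrC subr_gt0. Qed.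

Lemma step_size_sq n : step_size n ^+ 2 = c ^+ 2 * n%:R `^ (- (2 * alpha)).
Proof.
rewrite exprMn -[X in _ * X](powR_mulrn 2) ?powR_ge0 // -powRrM.
by congr (_ * _ `^ _); ring.
Qed.

Lemma step_size_sq_le n : (1 <= n)%N ->
  step_size n ^+ 2 <= 4 * c ^+ 2 * n.+1%:R `^ (- (2 * alpha)).
Proof.
move=> n1; rewrite step_size_sq [4 * _]mulrC -[leRHS]mulrA ler_wpM2l ?sqr_ge0 //.
have a2 : 0 <= 2 * alpha <= 2.
  by move: alpha_gt alpha_lt => h1 h2; apply/andP; split; lra.
have n0 : 0 < n%:R :> R by rewrite ltr0n.
rewrite !powRN ler_pdivlMr ?powR_gt0 // mulrC ler_pdivrMr ?powR_gt0 //.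
exact: natS_powR_le.
Qed.

Lemma drift_ge0 n w : 0 <= drift n w.
Proof.
apply: le_trans (Phi_monotone (Z n w)).
by rewrite divr_ge0 ?addr_ge0 ?mulr_ge0 ?sqr_ge0 // ltW.
Qed.

(** The drift is nonnegative, so the squared error increases on average by at most the squared step,
    summable because alpha > 1/2; [B] dominates its tail. *)
Lemma err_ae_bounded :
  {ae P, forall w, exists M, forall n, (1 <= n)%N -> `|err n w| <= M}.
Proof.
pose B n : R := 4 * c ^+ 2 / (2 * alpha - 1) * n%:R `^ (- (2 * alpha - 1)).
have := @supermartingale_ae_bounded _ _ _ P (fun n => F n) past_setI
  (@pastS _ _ _ P _ _ Xs) (@past_measurable _ _ _ P _ _ Xs) sqerr B 1%N.
have K0 : 0 <= 4 * c ^+ 2 / (2 * alpha - 1).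
  by rewrite divr_ge0 ?mulr_ge0 ?sqr_ge0 // ltW.
case.
- by move=> n L n1; apply: past_sublevel; exact: sqerr_adapted.
- exact: sqerr_integrable.
- exact: sqerr_ge0.
- by move=> n; rewrite mulr_ge0 ?powR_ge0.
- move=> n A n1 FA; apply: le_trans (sqerr_step n1 FA) _; apply: lerD.
    apply: le_Rintegral => //.
    + apply: integrable_indicM; first exact: past_measurable FA.
      apply: RintegrableB; first exact: sqerr_integrable.
      exact/RintegrableZ/drift_integrable.
    + apply: integrable_indicM; first exact: past_measurable FA.
      exact: sqerr_integrable.
    + move=> w _; rewrite ler_wpM2l ?indicE // gerBl mulr_ge0 ?drift_ge0 //.
      by rewrite mulr_ge0 // step_size_ge0.
  apply: le_trans (step_size_sq_le n1) _.
  rewrite /B -mulrBr -ler_pdivrMl ?divr_gt0 ?mulr_gt0 ?exprn_gt0 //.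
  apply: le_trans (natr_powRN_diff_ge a21 n1).
  rewrite [1 + _]addrC subrK invf_div mulrA le_eqVlt; apply/orP; left; apply/eqP.
  by field; rewrite gt_eqF.
move=> N [mN N0 sN]; exists N; split=> // w nw; apply: sN => /= -[L HL].
(* Uses x <= 1 + x^2. *)
apply: nw; exists (1 + L) => n n1.
have := HL n n1; rewrite /sqerr; move: (normr_ge0 (err n w)).
by move: (`|_|) => x x0 ?; nra.
Qed.

(** Constrains all errors up to [n], so it is a past event and decreases with [n]: the truncated
    squared error still satisfies a one-step inequality. *)
Fixpoint trunc (M : R) n : set T :=
  if n is n'.+1 then trunc M n' `&` [set w | `|err n w| <= M] else setT.

Lemma truncP M n w : trunc M n w <->
  forall k, (1 <= k <= n)%N -> `|err k w| <= M.
Proof.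
elim: n => [|n IH] /=; first by split=> // _ [|k].
split=> [[/IH H1 H2] k /andP[k1]|H1].
  rewrite leq_eqVlt => /orP[/eqP->//|]; rewrite ltnS => kn.
  by apply: H1; rewrite k1.
split; last by apply: H1; rewrite leqnn.
by apply/IH => k /andP[k1 kn]; apply: H1; rewrite k1 leqW.
Qed.

Lemma trunc_past M n : F n (trunc M n).
Proof.
elim: n => [|n IH]; first exact: (@measurableT _ (past Xs 0)).
apply: past_setI; first exact: pastS.
by apply: past_sublevel; apply: measurable_norm; exact: err_adapted.
Qed.

Let trunc_measurable M n : measurable (trunc M n).
Proof. exact: past_measurable (@trunc_past M n). Qed.

Definition tsqerr M n w : R := \1_(trunc M n) w * sqerr n w.

Lemma tsqerr_ge0 M n w : 0 <= tsqerr M n w.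
Proof. by rewrite mulr_ge0 ?sqerr_ge0 // indicE. Qed.

Lemma tsqerr_adapted M n : (1 <= n)%N ->
  measurable_fun setT (tsqerr M n : past Xs n -> R).
Proof.
move=> n1; apply: measurable_funM; last exact: sqerr_adapted.
by apply: (@measurable_indic _ (past Xs n)); exact: trunc_past.
Qed.

Lemma tsqerr_integrable M n : (1 <= n)%N -> integ (tsqerr M n).
Proof. by move=> n1; apply: integrable_indicM => //; exact: sqerr_integrable. Qed.

Lemma tsqerr_le M n w : 0 <= M -> (1 <= n)%N -> tsqerr M n w <= M ^+ 2.
Proof.
move=> M0 n1; rewrite /tsqerr indicE; have [|_] := boolP (w \in _).
  rewrite in_setE => /truncP/(_ n); rewrite leqnn n1 => /(_ isT) wM.
  by rewrite mul1r lerXn2r ?nnegrE.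
by rewrite mul0r sqr_ge0.
Qed.

Lemma tsqerr_step M n A : 0 <= M -> (1 <= n)%N -> F n A ->
  \int[P]_w (\1_A w * tsqerr M n.+1 w) <=
  (1 - 2 * lam / (1 + M) * step_size n) * \int[P]_w (\1_A w * tsqerr M n w) +
  step_size n ^+ 2.
Proof.
move=> M0 n1 FA; have mA := past_measurable FA.
have FS : F n (A `&` trunc M n) by apply: past_setI => //; exact: trunc_past.
have mS := past_measurable FS.
have Iq := sqerr_integrable n1.
have Iq' : integ (sqerr n.+1) by exact: sqerr_integrable.
have It := tsqerr_integrable M n1.
have It' : integ (tsqerr M n.+1) by exact: tsqerr_integrable.
have I1 := integrable_indicM mS Iq'.
have I2 : integ (fun w => \1_(A `&` trunc M n) w *
    (sqerr n w - 2 * step_size n * drift n w)).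
  apply: integrable_indicM => //; apply: RintegrableB => //.
  exact/RintegrableZ/drift_integrable.
have I3 := integrable_indicM mA It; have I4 := integrable_indicM mA It'.
(* Enlarging [trunc M n.+1] to [trunc M n] gives an event of the past at time [n], to which
   [sqerr_step] applies. *)
apply: (@le_trans _ _ (\int[P]_w (\1_(A `&` trunc M n) w * sqerr n.+1 w))).
  apply: le_Rintegral => // w _.
  rewrite indicI /= -mulrA ler_wpM2l ?indicE // /tsqerr ler_wpM2r ?sqerr_ge0 //.
  rewrite !indicE ler_nat; have [|//] := boolP (w \in trunc M n.+1).
  by rewrite in_setE => -[H1 _]; rewrite mem_set.
apply: le_trans (sqerr_step n1 FS) _; rewrite lerD2r.
rewrite -RintegralZl //; apply: le_Rintegral => //; first exact: RintegrableZ.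
move=> w _; rewrite indicI /= /tsqerr !indicE.
have [_|_] := boolP (w \in A); last by rewrite !mul0r mulr0.
have [|_] := boolP (w \in trunc M n); last by rewrite mulr0 !mul0r !mulr0.
rewrite in_setE => /truncP/(_ n); rewrite leqnn n1 => /(_ isT) wM.
rewrite !mul1r mulrBl mul1r lerD2l lerN2.
have := Phi_monotone (Z n w); rewrite -/(drift n w) -/(sqerr n w) => H1.
have g0 := step_size_ge0 n.
have H2 : lam * sqerr n w / (1 + M) <= drift n w.
  apply: le_trans H1; rewrite ler_wpM2l ?mulr_ge0 ?sqerr_ge0 ?(ltW lam_gt0) //.
  by rewrite lef_pV2 ?posrE ?ltr_pwDl // lerD2l.
rewrite (_ : 2 * lam / _ * _ * _ =
  2 * step_size n * (lam * sqerr n w / (1 + M))); last by ring.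
by rewrite ler_wpM2l // mulr_ge0.
Qed.

Let alpha01 : 0 < alpha < 1.
Proof. by move: alpha_gt alpha_lt => h1 h2; apply/andP; split; lra. Qed.

Lemma tsqerr_rate M : 0 <= M -> exists2 K : R, 0 <= K & forall n,
  (1 <= n)%N -> \int[P]_w tsqerr M n w <= K * n%:R `^ (- alpha).
Proof.
move=> M0; have k0 : 0 < 2 * lam / (1 + M).
  by rewrite divr_gt0 ?mulr_gt0 // ltr_pwDl.
apply: (@robbins_monro_rate _ _ c (2 * lam / (1 + M)) (M ^+ 2)) => //.
- exact: sqr_ge0.
- move=> n n1; rewrite -[leRHS](Rintegral_cstP P); apply: le_Rintegral => //.
  + exact: tsqerr_integrable.
  + exact: (@bounded_integrable _ _ _ _ _ `|M ^+ 2|).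
  + by move=> w _; exact: tsqerr_le.
move=> n n1; have FT : F n setT by exact: (@measurableT _ (past Xs n)).
have := tsqerr_step M0 n1 FT.
by under eq_Rintegral do rewrite indicT mul1r;
   under [X in _ * X]eq_Rintegral do rewrite indicT mul1r.
Qed.

(** * Almost sure rates of the truncated errors *)

Context (delta : R) (delta_gt0 : 0 < delta).

Let logw n : R := ln n%:R `^ (1 + delta).

Let logw_ge0 n : 0 <= logw n. Proof. exact: powR_ge0. Qed.

Let logw_gt0 n : (2 <= n)%N -> 0 < logw n.
Proof. by move=> n2; rewrite powR_gt0 // ln_gt0 // ltr1n. Qed.

Let logw_le n : (2 <= n)%N -> logw n <= logw n.+1.
Proof.
move=> n2; have n1 : (1 <= n)%N by exact: leq_trans n2.
apply: ge0_ler_powR; rewrite ?nnegrE ?ln_ge0 ?ler1n //.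
  by rewrite addr_ge0 // ltW.
by rewrite ler_ln ?posrE ?ltr0n // ler_nat.
Qed.

Let logw_ge1 : \forall n \near \oo, 1 <= logw n.
Proof.
have := ln_natr_large (1 : R); apply: filterS => n n1.
apply: (le_trans n1); apply: (le1r_powR n1).
by rewrite lerDl ltW.
Qed.

Let log_potential (C : R) n : (2 <= n)%N -> 0 <= C ->
  C / (n.+1%:R * logw n.+1) <=
  C / delta * ln n%:R `^ (- delta) - C / delta * ln n.+1%:R `^ (- delta).
Proof.
move=> n2 C0; rewrite -mulrBr -mulrA ler_wpM2l // ler_pdivlMl //.
by rewrite invfM -powRN; exact: ln_powRN_diff_ge.
Qed.

Let log_potential_cvg (C : R) : C / delta * ln n%:R `^ (- delta) @[n --> \oo] --> 0.
Proof.
rewrite -[X in _ --> X](mulr0 (C / delta)).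
by apply: cvgMr; apply: cvg_powRN => //; exact: ln_natr_large.
Qed.

(** The weight [r n] turns the squared step into a multiple of 1 / (n (ln n)^(1 + delta)), which is
    summable. Its growth, of relative size 1 / n, is absorbed by the contraction from [N] on, and
    the weighted mean is O(n^(alpha - 1)). *)
Lemma tsqerr_ae_rate M : 0 <= M -> {ae P, forall w,
  n%:R `^ (2 * alpha - 1) / logw n * tsqerr M n w @[n --> \oo] --> 0}.
Proof.
move=> M0; set r := fun n => n%:R `^ (2 * alpha - 1) / logw n.
have k0 : 0 < 2 * lam / (1 + M).
  by rewrite divr_gt0 ?mulr_gt0 // ltr_pwDl.
have r0 n : 0 <= r n by rewrite divr_ge0 ?powR_ge0.
have a10 : 0 < 1 - alpha by rewrite subr_gt0.
have [N1 _ HN1] := natr_powR_large (2 * lam / (1 + M) * c)^-1 a10.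
pose N := maxn N1 2.
have N2 : (2 <= N)%N by rewrite leq_maxr.
have [K K0 HK] := tsqerr_rate M0.
pose B n : R := 4 * c ^+ 2 / delta * ln n%:R `^ (- delta).
have C0 : 0 <= 4 * c ^+ 2 by rewrite mulr_ge0 ?sqr_ge0.
have rS n : (N <= n)%N ->
    r n.+1 * (1 - 2 * lam / (1 + M) * step_size n) <= r n.
  move=> Nn; have n2 : (2 <= n)%N by exact: leq_trans Nn.
  have n0 : 0 < n%:R :> R by rewrite ltr0n (leq_trans _ n2).
  have H1 : (2 * lam / (1 + M) * c)^-1 <= n%:R `^ (1 - alpha).
    by apply: HN1; apply: leq_trans Nn; rewrite leq_maxl.
  have H2 : n%:R^-1 <= 2 * lam / (1 + M) * step_size n.
    have kc0 : 0 < 2 * lam / (1 + M) * c by rewrite mulr_gt0.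
    rewrite /step_size mulrA -(ler_pM2l n0) mulfV ?gt_eqF //.
    rewrite mulrCA -ler_pdivrMl // mulr1.
    by move: H1; rewrite powRD ?powRr1 ?(gt_eqF n0) ?implybT.
  have H3 : n.+1%:R `^ (2 * alpha - 1) * (1 - n%:R^-1) <= n%:R `^ (2 * alpha - 1).
    have q01 : 0 <= 2 * alpha - 1 <= 1.
      by rewrite (ltW a21) /= lerBlDr; move: alpha_lt => h; lra.
    have n1 : (1 <= n)%N by exact: leq_trans n2.
    have := natS_powRN_ge q01 n1; rewrite !powRN.
    have p0 : 0 < n%:R `^ (2 * alpha - 1) :> R by rewrite powR_gt0.
    have p1 : 0 < n.+1%:R `^ (2 * alpha - 1) :> R by rewrite powR_gt0.
    by rewrite ler_pdivrMl // ler_pdivlMr // mulrC.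
  apply: (@le_trans _ _ (r n.+1 * (1 - n%:R^-1))).
    by rewrite ler_wpM2l // lerB.
  rewrite /r mulrAC; apply: (@le_trans _ _ (n%:R `^ (2 * alpha - 1) / logw n.+1)).
    by rewrite ler_wpM2r ?invr_ge0.
  rewrite ler_wpM2l ?powR_ge0 // lef_pV2 ?posrE ?logw_gt0 ?logw_le //.
  exact: leqW.
apply: (@supermartingale_ae_cvg0 _ _ _ P (fun n => F n) past_setI
  (@pastS _ _ _ P _ _ Xs) (@past_measurable _ _ _ P _ _ Xs)
  (fun n w => r n * tsqerr M n w) B N).
- move=> n L Nn; apply: past_sublevel; apply: measurable_funM => //.
  by apply: tsqerr_adapted; apply: leq_trans Nn; exact: leq_trans N2.
- move=> n Nn; apply: RintegrableZ; apply: tsqerr_integrable.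
  by apply: leq_trans Nn; exact: leq_trans N2.
- by move=> n w; rewrite mulr_ge0 ?tsqerr_ge0.
- by move=> n; rewrite mulr_ge0 ?powR_ge0 // divr_ge0 // ltW.
- move=> n A Nn FA; have n2 : (2 <= n)%N by exact: leq_trans Nn.
  have n1 : (1 <= n)%N by exact: leq_trans n2.
  have mA : measurable A by exact: (@past_measurable _ _ _ P _ _ Xs n).
  have It := integrable_indicM mA (tsqerr_integrable M n1).
  have It' : integ (fun w => \1_A w * tsqerr M n.+1 w).
    by apply: integrable_indicM => //; exact: tsqerr_integrable.
  under eq_Rintegral do rewrite mulrCA.
  under [X in _ <= X + _]eq_Rintegral do rewrite mulrCA.
  rewrite !RintegralZl //.
  apply: le_trans (ler_wpM2l (r0 n.+1) (tsqerr_step M0 n1 FA)) _.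
  rewrite mulrDr lerD //.
    rewrite mulrA ler_wpM2r ?rS //.
    by apply: Rintegral_ge0 => w _; rewrite mulr_ge0 ?tsqerr_ge0 // indicE.
  apply: le_trans (log_potential n2 C0).
  apply: le_trans (ler_wpM2l (r0 n.+1) (step_size_sq_le n1)) _.
  have E : n.+1%:R `^ (2 * alpha - 1) * n.+1%:R `^ (- (2 * alpha)) =
      n.+1%:R^-1 :> R.
    rewrite -powRD ?pnatr_eq0 ?implybT // (_ : _ + _ = -1); last by ring.
    exact: powR_inv1.
  by rewrite le_eqVlt; apply/orP; left; apply/eqP; rewrite invfM -E /r; ring.
- have rate : n%:R `^ (- (1 - alpha)) @[n --> \oo] --> (0 : R).
    by apply: cvg_powRN => //; exact: natr_large.
  have {}rate : K * n%:R `^ (- (1 - alpha)) @[n --> \oo] --> (0 : R).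
    by rewrite -[X in _ --> X](mulr0 K); exact: cvgMr.
  apply: squeeze_cvgr (cvg_cst 0) rate.
  near=> n.
  have n2 : (2 <= n)%N by near: n; exists 2%N.
  have n1 : (1 <= n)%N by exact: leq_trans n2.
  have n0 : 0 < n%:R :> R by rewrite ltr0n.
  have L1 : 1 <= logw n by near: n; exact: logw_ge1.
  rewrite RintegralZl //; last exact: tsqerr_integrable.
  apply/andP; split.
    by rewrite mulr_ge0 // Rintegral_ge0 // => w _; exact: tsqerr_ge0.
  apply: (@le_trans _ _ (n%:R `^ (2 * alpha - 1) * (K * n%:R `^ (- alpha)))).
    apply: ler_pM => //; last exact: HK.
      by apply: Rintegral_ge0 => w _; exact: tsqerr_ge0.
    by rewrite ler_pdivrMr ?(lt_le_trans _ L1) // ler_peMr ?powR_ge0.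
  rewrite mulrCA -powRD ?(gt_eqF n0) ?implybT //.
  rewrite le_eqVlt; apply/orP; left; apply/eqP; congr (_ * _ `^ _); ring.
- exact: log_potential_cvg.
Unshelve. all: by end_near.
Qed.

(** The normalisation decreases, so one step adds at most (n + 1)^(- 1/2) E x_(n+1) = O(n^(- 1/2 -
    p)), summable for p > 1/2; the normalised mean is O(n^(1/2 - p)). *)
Lemma weighted_sum_ae_cvg0 (x : nat -> T -> R) (C p : R) : 1 / 2 < p -> p < 1 ->
  0 <= C ->
  (forall n, (1 <= n)%N -> measurable_fun setT (x n : past Xs n -> R)) ->
  (forall n, (1 <= n)%N -> integ (x n)) ->
  (forall n w, 0 <= x n w) ->
  (forall n, (1 <= n)%N -> \int[P]_w x n w <= C * n%:R `^ (- p)) ->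
  {ae P, forall w, n%:R `^ (- 2^-1) * \sum_(1 <= k < n.+1) x k w
     @[n --> \oo] --> 0}.
Proof.
move=> p2 p1 C0 ax Ix x0 xC.
have q0 : 0 < p - 2^-1 by rewrite subr_gt0 -div1r.
have p01 : 0 < p < 1.
  by rewrite p1 andbT (lt_trans _ p2) // divr_gt0.
pose S n w := \sum_(1 <= k < n.+1) x k w.
have SS n w : (1 <= n)%N -> S n.+1 w = S n w + x n.+1 w.
  by move=> n1; rewrite /S big_nat_recr.
have S0 n w : 0 <= S n w by apply: sumr_ge0.
have aS n : measurable_fun setT (S n : past Xs n -> R).
  elim: n => [|n IH].
    rewrite (_ : S 0%N = fun=> 0) //; last first.
    by apply/funext => w; rewrite /S big_geq.
  rewrite (_ : S n.+1 = fun w => S n w + x n.+1 w); last first.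
    by apply/funext => w; rewrite /S big_nat_recr.
  apply: measurable_funD; last exact: ax.
  by move=> _ B mB; apply: pastS; exact: (IH measurableT B mB).
have IS n : integ (S n).
  elim: n => [|n IH].
    rewrite (_ : S 0%N = fun=> 0); last first.
      by apply/funext => w; rewrite /S big_geq.
    exact: (@bounded_integrable _ _ _ _ _ `|0 : R|).
  rewrite (_ : S n.+1 = fun w => S n w + x n.+1 w); last first.
    by apply/funext => w; rewrite /S big_nat_recr.
  by apply: RintegrableD => //; exact: Ix.
have ES n : \int[P]_w S n w <= C * (2 / (1 - p) * n%:R `^ (1 - p)).
  apply: (@le_trans _ _ (C * \sum_(1 <= k < n.+1) k%:R `^ (- p))); last first.
    by rewrite ler_wpM2l //; exact: sum_powRN_le.
  elim: n => [|n IH].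
    rewrite big_geq // mulr0 -[leRHS](Rintegral_cstP P) le_eqVlt; apply/orP; left.
    by apply/eqP; apply: eq_Rintegral => w _; rewrite /S big_geq.
  rewrite big_nat_recr //= mulrDr; apply: le_trans (lerD IH (xC n.+1 _)) => //.
  rewrite -RintegralD //; last exact: Ix.
  by rewrite le_eqVlt; apply/orP; left; apply/eqP; apply: eq_Rintegral => w _;
    rewrite /S big_nat_recr.
pose B n : R := C / (p - 2^-1) * n%:R `^ (- (p - 2^-1)).
have root0 n : 0 <= n%:R `^ (- 2^-1) :> R by exact: powR_ge0.
apply: (@supermartingale_ae_cvg0 _ _ _ P (fun n => F n) past_setI
  (@pastS _ _ _ P _ _ Xs) (@past_measurable _ _ _ P _ _ Xs)
  (fun n w => n%:R `^ (- 2^-1) * S n w) B 1%N).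
- by move=> n L n1; apply: past_sublevel; apply: measurable_funM.
- by move=> n n1; exact: RintegrableZ.
- by move=> n w; rewrite mulr_ge0.
- by move=> n; rewrite mulr_ge0 ?powR_ge0 // divr_ge0 // ltW.
- move=> n A n1 FA; have mA : measurable A by exact: (@past_measurable _ _ _ P _ _ Xs n).
  have n0 : 0 < n%:R :> R by rewrite ltr0n.
  have n01 : 0 < n.+1%:R :> R by rewrite ltr0n.
  have I1 : integ (fun w => n%:R `^ (- 2^-1) * S n w) by exact: RintegrableZ.
  have I2 : integ (fun w => n.+1%:R `^ (- 2^-1) * x n.+1 w).
    by apply: RintegrableZ; exact: Ix.
  apply: (@le_trans _ _ (\int[P]_w (\1_A w * (n%:R `^ (- 2^-1) * S n w) +
      n.+1%:R `^ (- 2^-1) * x n.+1 w))).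
    apply: le_Rintegral => //.
    + by apply: integrable_indicM => //; apply: RintegrableZ.
    + by apply: RintegrableD => //; exact: integrable_indicM.
    move=> w _; rewrite indicE; case: (w \in A); last first.
      by rewrite !mul0r add0r mulr_ge0.
    rewrite !mul1r SS // mulrDr lerD2r ler_wpM2r //.
    rewrite !powRN lef_pV2 ?posrE ?powR_gt0 //.
    by apply: ge0_ler_powR; rewrite ?nnegrE ?ler_nat.
  rewrite RintegralD //; last exact: integrable_indicM.
  rewrite lerD2l RintegralZl //; last exact: Ix.
  apply: le_trans (ler_wpM2l (root0 n.+1) (xC n.+1 _)) _ => //.
  rewrite /B -mulrBr -[X in _ <= X]mulrA mulrCA ler_wpM2l // ler_pdivlMl //.
  apply: le_trans (natr_powRN_diff_ge q0 n1).
  rewrite -powRD ?(gt_eqF n01) ?implybT //.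
  by rewrite le_eqVlt; apply/orP; left; apply/eqP; congr (_ * _ `^ _); field.
- have rate : n%:R `^ (- (p - 2^-1)) @[n --> \oo] --> (0 : R).
    by apply: cvg_powRN => //; exact: natr_large.
  have {}rate : C * (2 / (1 - p)) * n%:R `^ (- (p - 2^-1)) @[n --> \oo] --> (0 : R).
    by rewrite -[X in _ --> X](mulr0 (C * (2 / (1 - p)))); exact: cvgMr.
  apply: squeeze_cvgr (cvg_cst 0) rate.
  near=> n.
  have n1 : (1 <= n)%N by near: n; exists 1%N.
  have n0 : 0 < n%:R :> R by rewrite ltr0n.
  rewrite RintegralZl //; apply/andP; split.
    by rewrite mulr_ge0 // Rintegral_ge0.
  apply: le_trans (ler_wpM2l (root0 n) (ES n)) _.
  rewrite (_ : _ * (C * _) = C * (2 / (1 - p)) *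
    (n%:R `^ (- 2^-1) * n%:R `^ (1 - p))); last by ring.
  rewrite ler_wpM2l ?mulr_ge0 // ?invr_ge0 ?subr_ge0 ?(ltW p1) //.
  rewrite -powRD ?(gt_eqF n0) ?implybT //.
  by rewrite le_eqVlt; apply/orP; left; apply/eqP; congr (_ `^ _); field.
- rewrite -[X in _ --> X](mulr0 (C / (p - 2^-1))).
  by apply: cvgMr; apply: cvg_powRN => //; exact: natr_large.
Unshelve. all: by end_near.
Qed.

Lemma tsqerr_sum_ae_cvg0 M : 0 <= M -> {ae P, forall w,
  n%:R `^ (- 2^-1) * \sum_(1 <= k < n.+1) tsqerr M k w @[n --> \oo] --> 0}.
Proof.
move=> M0; have [K K0 HK] := tsqerr_rate M0.
apply: (weighted_sum_ae_cvg0 alpha_gt alpha_lt K0) => //.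
- exact: tsqerr_adapted.
- exact: tsqerr_integrable.
- exact: tsqerr_ge0.
Qed.

Let terr M n w : R := \1_(trunc M n) w * `|err n w|.

Let terr_sq M n w : terr M n w ^+ 2 = tsqerr M n w.
Proof.
rewrite /terr /tsqerr exprMn indicE; case: (w \in _); first by rewrite expr1n.
by rewrite expr0n.
Qed.

(** Here p = 1 - alpha / 2, since E |T_k| = O(k^(- alpha / 2)) under truncation; p > 1/2 amounts to
    alpha < 1. *)
Lemma terr_sum_ae_cvg0 M : 0 <= M -> {ae P, forall w,
  n%:R `^ (- 2^-1) * \sum_(1 <= k < n.+1) k%:R `^ (alpha - 1) * terr M k w
    @[n --> \oo] --> 0}.
Proof.
move=> M0; have [K K0 HK] := tsqerr_rate M0.
have Ierr n : (1 <= n)%N -> integ (fun w => `|err n w|).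
  move=> n1; apply: integrable_bounded.
    apply: (@past_measurable_fun n); apply: measurable_norm.
    exact: (err_adapted n1).
  by have [B HB] := err_bounded n1; exists B => w; rewrite normr_id.
have Iterr n : (1 <= n)%N -> integ (terr M n).
  by move=> n1; apply: integrable_indicM => //; exact: Ierr.
have p2 : 1 / 2 < 1 - alpha / 2 by move: alpha_lt => h; lra.
have p1 : 1 - alpha / 2 < 1 by move: alpha01 => /andP[h _]; lra.
have C0 : 0 <= (K + 1) / 2 by rewrite divr_ge0 // addr_ge0.
apply: (weighted_sum_ae_cvg0 p2 p1 C0).
- move=> n n1; apply: measurable_funM => //; apply: measurable_funM.
    by apply: (@measurable_indic _ (past Xs n)); exact: trunc_past.
  by apply: measurable_norm; exact: (err_adapted n1).
- by move=> n n1; apply: RintegrableZ; exact: Iterr.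
- by move=> n w; rewrite !mulr_ge0 ?powR_ge0 // indicE.
move=> n n1; have n0 : 0 < n%:R :> R by rewrite ltr0n.
rewrite RintegralZl //; last exact: Iterr.
have -> : (K + 1) / 2 * n%:R `^ (- (1 - alpha / 2)) =
    n%:R `^ (alpha - 1) * ((K + 1) / 2 * n%:R `^ (- (alpha / 2))).
  rewrite [RHS]mulrCA -powRD ?(gt_eqF n0) ?implybT //.
  by congr (_ * _ `^ _); field.
rewrite ler_wpM2l ?powR_ge0 //.
(* Young's inequality u <= (s u^2 + 1 / s) / 2 with this [s] balances both terms and yields the
   constant (K + 1) / 2. *)
pose s : R := n%:R `^ (alpha / 2).
have s0 : 0 < s by exact: powR_gt0.
have It := tsqerr_integrable M n1.
have Ic : integ (fun=> s^-1 / 2).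
  exact: (@bounded_integrable _ _ _ _ _ `|s^-1 / 2|).
apply: (@le_trans _ _ (\int[P]_w (s / 2 * tsqerr M n w + s^-1 / 2))).
  apply: le_Rintegral => //; first exact: Iterr.
    by apply: RintegrableD => //; exact: RintegrableZ.
  move=> w _; rewrite -terr_sq; set u := terr M n w.
  rewrite -subr_ge0 (_ : _ - u = s^-1 / 2 * (s * u - 1) ^+ 2); last first.
    by field; rewrite gt_eqF.
  by rewrite mulr_ge0 ?sqr_ge0 // divr_ge0 // invr_ge0 ltW.
rewrite RintegralD //; last exact: RintegrableZ.
rewrite Rintegral_cstP RintegralZl //.
apply: (@le_trans _ _ (s / 2 * (K * n%:R `^ (- alpha)) + s^-1 / 2)).
  by rewrite lerD2r ler_wpM2l ?HK // divr_ge0 // ltW.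
have -> : n%:R `^ (- alpha) = s^-1 * s^-1.
  by rewrite /s -powRN -powRD ?(gt_eqF n0) ?implybT //; congr (_ `^ _); field.
rewrite powRN -/s le_eqVlt; apply/orP; left; apply/eqP; field.
by rewrite gt_eqF.
Qed.

(** * The martingale of the noise and the summation by parts *)

Definition mart n w : H := \sum_(1 <= k < n) noise k w.

Lemma martS n w : (1 <= n)%N -> mart n.+1 w = mart n w + noise n w.
Proof. by move=> n1; rewrite /mart big_nat_recr. Qed.

(** [noise k] involves the sample of index [k.+1], which is why the sum in [mart n] stops at k <
    n. *)
Lemma mart_adapted n : (1 <= n)%N -> adapted n (mart n).
Proof.
elim: n => [//|[_ _|n IH _]].
  rewrite (_ : mart 1 = fun=> 0); first exact: borel_measurable_cst.
  by apply/funext => w; rewrite /mart big_geq.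
rewrite (_ : mart n.+2 = fun w => mart n.+1 w + noise n.+1 w); last first.
  by apply/funext => w; rewrite martS.
apply: borel_measurable_add => //; first exact: (adaptedS (IH _)).
exact: noise_adapted.
Qed.

Lemma mart_bounded n w : (1 <= n)%N -> `|mart n w| <= 2 * n%:R.
Proof.
elim: n => [//|[_ _|n IH _]].
  by rewrite /mart big_geq // normr0 mulr_ge0.
rewrite martS // -[n.+2]addn1 natrD mulrDr mulr1.
by rewrite (le_trans (ler_normD _ _)) // lerD ?IH // noise_le2.
Qed.

Lemma mart_sq_measurable n : (1 <= n)%N ->
  measurable_fun setT ((fun w => `|mart n w| ^+ 2) : past Xs n -> R).
Proof.
by move=> n1; apply: measurable_funX; apply: measurable_norm; exact: mart_adapted.
Qed.

Lemma mart_sq_integrable n : (1 <= n)%N -> integ (fun w => `|mart n w| ^+ 2).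
Proof.
move=> n1; apply: (@bounded_integrable _ _ _ _ _ ((2 * n%:R) ^+ 2)) => [|w].
  exact: past_measurable_fun (mart_sq_measurable n1).
by rewrite ger0_norm ?sqr_ge0 // lerXn2r ?nnegrE ?mulr_ge0 // mart_bounded.
Qed.

Lemma mart_sq_step n A : (1 <= n)%N -> F n A ->
  \int[P]_w (\1_A w * `|mart n.+1 w| ^+ 2) <=
  \int[P]_w (\1_A w * `|mart n w| ^+ 2) + 4.
Proof.
move=> n1 FA; have mA := past_measurable FA.
have bm w : `|mart n w| <= 2 * n%:R by exact: mart_bounded.
have ortho := noise_orthogonal n1 FA (mart_adapted n1) bm.
have I1 := integrable_indicM mA (mart_sq_integrable n1).
have I1' : integ (fun w => \1_A w * `|mart n.+1 w| ^+ 2).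
  by apply: integrable_indicM => //; exact: mart_sq_integrable.
have I2 : integ (fun w => \1_A w * dot (noise n w) (mart n w)).
  apply: integrable_indicM => //; apply: integrable_bounded.
    apply: (@past_measurable_fun n.+1); apply: measurable_dot => //.
      exact: (noise_adapted n1).
    exact: (adaptedS (mart_adapted n1)).
  by exists (2 * (2 * n%:R)) => w; apply: ler_dot => //; exact: noise_le2.
have Ic : integ (fun=> 4 : R) by exact: (@bounded_integrable _ _ _ _ _ `|4 : R|).
have -> : \int[P]_w (\1_A w * `|mart n w| ^+ 2) + 4 = \int[P]_w
   ((\1_A w * `|mart n w| ^+ 2 + 2 * (\1_A w * dot (noise n w) (mart n w))) + 4).
  rewrite RintegralD ?Rintegral_cstP //; last first.
    by apply: RintegrableD => //; exact: RintegrableZ.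
  rewrite RintegralD //; last exact: RintegrableZ.
  by rewrite RintegralZl // ortho mulr0 addr0.
apply: le_Rintegral => //.
  by apply: RintegrableD => //; apply: RintegrableD => //; exact: RintegrableZ.
move=> w _; rewrite indicE; case: (w \in A); last by rewrite !mul0r mulr0 !add0r.
rewrite !mul1r martS // (normDsq dot_norm) (dotC dot (noise n w)) lerD2l.
by rewrite (_ : 4 = 2 ^+ 2) ?lerXn2r ?nnegrE ?noise_le2 // -natrX.
Qed.

(** Orthogonality and |noise| <= 2 give E |mart n|^2 <= 4 n. The weight decreases, so one step adds
    at most 4 / ((n + 1) (ln (n + 1))^(1 + delta)), and the weighted mean is at most 4 / (ln n)^(1 +
    delta). *)
Lemma mart_ae_rate : {ae P, forall w,
  (n%:R * logw n)^-1 * `|mart n w| ^+ 2 @[n --> \oo] --> 0}.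
Proof.
pose r n : R := (n%:R * logw n)^-1.
have r0 n : 0 <= r n by rewrite invr_ge0 mulr_ge0.
have E4 n : (1 <= n)%N -> \int[P]_w `|mart n w| ^+ 2 <= 4 * n%:R.
  elim: n => [//|[_ _|n IH _]].
    rewrite -[leRHS](Rintegral_cstP P); apply: le_Rintegral => //.
    - exact: mart_sq_integrable.
    - exact: (@bounded_integrable _ _ _ _ _ `|4 * 1%:R : R|).
    - by move=> w _; rewrite /mart big_geq // normr0 expr0n mulr_ge0.
  have FT : F n.+1 setT by exact: (@measurableT _ (past Xs n.+1)).
  have := mart_sq_step (ltn0Sn n) FT.
  under eq_Rintegral do rewrite indicT mul1r.
  under [X in _ <= X + _]eq_Rintegral do rewrite indicT mul1r.
  move=> /le_trans; apply; rewrite -[n.+2]addn1 natrD mulrDr mulr1 lerD2r.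
  exact: IH.
pose B n : R := 4 / delta * ln n%:R `^ (- delta).
apply: (@supermartingale_ae_cvg0 _ _ _ P (fun n => F n) past_setI
  (@pastS _ _ _ P _ _ Xs) (@past_measurable _ _ _ P _ _ Xs)
  (fun n w => r n * `|mart n w| ^+ 2) B 2%N).
- move=> n L n2; apply: past_sublevel; apply: measurable_funM => //.
  by apply: mart_sq_measurable; exact: leq_trans n2.
- move=> n n2; apply: RintegrableZ; apply: mart_sq_integrable.
  exact: leq_trans n2.
- by move=> n w; rewrite mulr_ge0 ?sqr_ge0.
- by move=> n; rewrite mulr_ge0 ?powR_ge0 // divr_ge0 // ltW.
- move=> n A n2 FA; have n1 : (1 <= n)%N by exact: leq_trans n2.
  have n0 : 0 < n%:R :> R by rewrite ltr0n.
  have mA : measurable A by exact: (@past_measurable _ _ _ P _ _ Xs n).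
  have I1 := integrable_indicM mA (mart_sq_integrable n1).
  have I1' : integ (fun w => \1_A w * `|mart n.+1 w| ^+ 2).
    by apply: integrable_indicM => //; exact: mart_sq_integrable.
  under eq_Rintegral do rewrite mulrCA.
  under [X in _ <= X + _]eq_Rintegral do rewrite mulrCA.
  rewrite !RintegralZl //.
  apply: le_trans (ler_wpM2l (r0 n.+1) (mart_sq_step n1 FA)) _.
  rewrite mulrDr lerD //.
    apply: ler_wpM2r.
      by apply: Rintegral_ge0 => w _; rewrite mulr_ge0 ?sqr_ge0 // indicE.
    have L0 := logw_gt0 n2; have L0' := logw_gt0 (leqW n2).
    rewrite lef_pV2 ?posrE ?mulr_gt0 ?ltr0n //.
    by rewrite ler_pM ?logw_le // ler_nat.
  have /= := @log_potential 4 n n2; rewrite mulrC; apply.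
  by [].
- have rate : 4 * (logw n)^-1 @[n --> \oo] --> (0 : R).
    rewrite -[X in _ --> X](mulr0 4); apply: cvgMr.
    under eq_fun do rewrite -powRN.
    by apply: cvg_powRN; [rewrite addr_gt0|exact: ln_natr_large].
  apply: squeeze_cvgr (cvg_cst 0) rate.
  near=> n.
  have n2 : (2 <= n)%N by near: n; exists 2%N.
  have n1 : (1 <= n)%N by exact: leq_trans n2.
  have n0 : 0 < n%:R :> R by rewrite ltr0n.
  have L0 := logw_gt0 n2.
  rewrite RintegralZl //; last exact: mart_sq_integrable.
  apply/andP; split.
    by rewrite mulr_ge0 // Rintegral_ge0 // => w _; exact: sqr_ge0.
  apply: le_trans (ler_wpM2l (r0 n) (E4 n n1)) _.
  rewrite /r le_eqVlt; apply/orP; left; apply/eqP; field.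
  by rewrite !gt_eqF.
- exact: log_potential_cvg.
Unshelve. all: by end_near.
Qed.

(* Summation by parts of [direction = (Z n.+1 - Z n) / step_size n]. *)
Lemma gradient_sum_decomposition n w : (1 <= n)%N ->
  `|mart n w - \sum_(1 <= k < n) Phi (Z k w) -
    (c^-1 * n%:R `^ alpha) *: err n w| <=
  c^-1 * \sum_(1 <= k < n.+1) k%:R `^ (alpha - 1) * `|err k w|.
Proof.
have /andP[a0 _] := alpha01.
have ic0 : 0 <= c^-1 by rewrite invr_ge0 ltW.
elim: n => [//|[_ _|n IH _]].
  rewrite /mart big_nat1 !big_geq // subrr sub0r normrN normrZ.
  by rewrite !powR1 mulr1 mul1r ger0_norm.
have {}IH := IH isT; rewrite martS // big_nat_recr //=.
rewrite [in leRHS]big_nat_recr //= mulrDr.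
have n0 : 0 < n.+1%:R :> R by rewrite ltr0n.
have s0 : 0 < n.+1%:R `^ alpha by exact: powR_gt0.
have D : noise n.+1 w = (c^-1 * n.+1%:R `^ alpha) *: (err n.+2 w - err n.+1 w) +
    Phi (Z n.+1 w).
  rewrite /noise (sgdS w (ltn0Sn n)) [_ + _ - m]addrAC [_ - m + _]addrC addrK.
  rewrite scalerA /step_size powRN.
  have -> : c^-1 * n.+1%:R `^ alpha * (c * (n.+1%:R `^ alpha)^-1) = 1.
    by field; rewrite !gt_eqF.
  by rewrite scale1r.
rewrite D; set G := \sum_(1 <= k < n.+1) _; set p := c^-1 * _ `^ alpha.
(* The step replaces the boundary weight c^-1 (n + 1)^alpha by c^-1 (n + 2)^alpha; the difference is
   at most c^-1 (n + 2)^(alpha - 1), the new term of the sum. *)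
rewrite (_ : mart n.+1 w + _ - _ - _ = (mart n.+1 w - G - p *: err n.+1 w) +
  (p - c^-1 * n.+2%:R `^ alpha) *: err n.+2 w).
  apply: le_trans (ler_normD _ _) _; apply: lerD => //.
  rewrite normrZ mulrA ler_wpM2r //.
  have pS : n.+1%:R `^ alpha <= n.+2%:R `^ alpha :> R.
    by apply: ge0_ler_powR; rewrite ?nnegrE ?(ltW a0) ?ler_nat.
  rewrite /p -mulrBr normrM ger0_norm // ler_wpM2l // distrC.
  rewrite ger0_norm ?subr_ge0 //; apply: natr_powR_diff_le => //.
  by rewrite !ltW // alpha_lt.
rewrite scalerBr scalerBl.
rewrite (_ : forall (x1 x2 x3 x4 x5 x6 : H),
  x1 + (x2 - x3 + x4) - (x5 + x4) - x6 = x1 - x5 - x3 + (x2 - x6)) //.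
move=> x1 x2 x3 x4 x5 x6; rewrite opprD.
rewrite !addrA [_ + x4 - x5]addrAC addrK [x1 + x2 - x3]addrAC.
by rewrite [_ + x2 - x5]addrAC [x1 - x3 - x5]addrAC.
Qed.

(** * The rate of the averaged error *)

Context (K : R) (K_gt0 : 0 < K).
Hypothesis average_le : forall (G : nat -> H) n,
  lam * `|n%:R^-1 *: \sum_(1 <= k < n.+1) G k| <=
  n%:R^-1 * (`|\sum_(1 <= k < n.+1) Phi (m + G k)| +
             K * \sum_(1 <= k < n.+1) `|G k| ^+ 2).

Let sqrt_le (x y e : R) : 0 <= x -> 0 <= y -> 0 <= e -> x ^+ 2 <= e ^+ 2 * y ->
  x <= e * y `^ 2^-1.
Proof.
move=> x0 y0 e0; have yE : y = (y `^ 2^-1) ^+ 2.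
  by rewrite -(powR_mulrn 2) ?powR_ge0 // -powRrM mulVf ?powRr1.
rewrite {1}yE -exprMn ler_pXn2r // nnegrE mulr_ge0 ?powR_ge0 //.
Qed.

Lemma average_err_rate w (M : R) : (forall n, (1 <= n)%N -> `|err n w| <= M) ->
  (n%:R * logw n)^-1 * `|mart n w| ^+ 2 @[n --> \oo] --> 0 ->
  n%:R `^ (2 * alpha - 1) / logw n * tsqerr M n w @[n --> \oo] --> 0 ->
  n%:R `^ (- 2^-1) * \sum_(1 <= k < n.+1) k%:R `^ (alpha - 1) * terr M k w
    @[n --> \oo] --> 0 ->
  n%:R `^ (- 2^-1) * \sum_(1 <= k < n.+1) tsqerr M k w @[n --> \oo] --> 0 ->
  forall e : R, 0 < e -> \forall n \near \oo,
    `|n%:R^-1 *: \sum_(1 <= k < n.+1) err k w| <=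
    e * (logw n `^ 2^-1 * n%:R `^ (- 2^-1)).
Proof.
move=> wM lim1 lim2 lim3 lim4 e e0.
have wtrunc n : w \in trunc M n.
  by rewrite in_setE; apply/truncP => k /andP[k1 _]; exact: wM.
have tsqE n : tsqerr M n w = `|err n w| ^+ 2.
  by rewrite /tsqerr indicE wtrunc mul1r.
have terrE n : terr M n w = `|err n w| by rewrite /terr indicE wtrunc mul1r.
have ic0 : 0 < c^-1 by rewrite invr_gt0.
(* One unit each for the last gradient and the martingale, c^-1 each for the boundary term and the
   sum by parts, and K for the quadratic term. *)
pose D := 2 + 2 * c^-1 + K.
have D0 : 0 < D by rewrite !addr_gt0 ?mulr_gt0.
pose eps := lam * e / D; have eps0 : 0 < eps by rewrite divr_gt0 ?mulr_gt0.
have eps2 : 0 < eps ^+ 2 by rewrite exprn_gt0.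
have lim0 : n%:R `^ (- 2^-1) @[n --> \oo] --> (0 : R).
  by apply: cvg_powRN; [rewrite invr_gt0|exact: natr_large].
near=> n.
have n2 : (2 <= n)%N by near: n; exists 2%N.
have n1 : (1 <= n)%N by exact: leq_trans n2.
have n0 : 0 < n%:R :> R by rewrite ltr0n.
have L1 : 1 <= logw n by near: n; exact: logw_ge1.
have L0 : 0 < logw n by exact: lt_le_trans L1.
have N0 : `|n%:R `^ (- 2^-1)| <= eps.
  by near: n; move/cvgr0Pnorm_le: lim0 => /(_ _ eps0).
have N1 : `|(n%:R * logw n)^-1 * `|mart n w| ^+ 2| <= eps ^+ 2.
  by near: n; move/cvgr0Pnorm_le: lim1 => /(_ _ eps2).
have N2 : `|n%:R `^ (2 * alpha - 1) / logw n * tsqerr M n w| <= eps ^+ 2.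
  by near: n; move/cvgr0Pnorm_le: lim2 => /(_ _ eps2).
have N3 : `|n%:R `^ (- 2^-1) *
    \sum_(1 <= k < n.+1) k%:R `^ (alpha - 1) * terr M k w| <= eps.
  by near: n; move/cvgr0Pnorm_le: lim3 => /(_ _ eps0).
have N4 : `|n%:R `^ (- 2^-1) * \sum_(1 <= k < n.+1) tsqerr M k w| <= eps.
  by near: n; move/cvgr0Pnorm_le: lim4 => /(_ _ eps0).
set L2 := logw n `^ 2^-1; set q := n%:R `^ (- 2^-1).
have L21 : 1 <= L2.
  by rewrite /L2 -(mul1r (_ `^ _)); apply: sqrt_le; rewrite ?expr1n ?mul1r.
have q0 : 0 < q by exact: powR_gt0.
have qq : q * q = n%:R^-1.
  by rewrite -powRD ?(gt_eqF n0) ?implybT // -opprD -[2^-1]div1r -splitr powR_inv1.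
have B0 : q <= eps * L2.
  apply: (@le_trans _ _ eps); last by rewrite ler_peMr // ltW.
  exact: le_trans (ler_norm _) N0.
have B1 : q * `|mart n w| <= eps * L2.
  apply: sqrt_le; [by rewrite mulr_ge0 ?(ltW q0)|exact: ltW|exact: ltW|].
  rewrite -ler_pdivrMr //.
  have -> : (q * `|mart n w|) ^+ 2 / logw n = (n%:R * logw n)^-1 * `|mart n w| ^+ 2.
    by rewrite exprMn expr2 qq invfM; ring.
  exact: le_trans (ler_norm _) N1.
have B2 : q * (n%:R `^ alpha * `|err n w|) <= eps * L2.
  apply: sqrt_le; [|exact: ltW|exact: ltW|].
    by rewrite !mulr_ge0 ?powR_ge0 ?(ltW q0).
  rewrite -ler_pdivrMr //.
  have -> : (q * (n%:R `^ alpha * `|err n w|)) ^+ 2 / logw n =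
      n%:R `^ (2 * alpha - 1) / logw n * tsqerr M n w.
    rewrite tsqE !exprMn expr2 qq -(powR_mulrn 2) ?powR_ge0 // -powRrM.
    rewrite powRD ?(gt_eqF n0) ?implybT // powR_inv1 // (mulrC alpha).
    by ring.
  exact: le_trans (ler_norm _) N2.
have B3 : q * \sum_(1 <= k < n.+1) k%:R `^ (alpha - 1) * `|err k w| <= eps * L2.
  apply: (@le_trans _ _ eps); last by rewrite ler_peMr // ltW.
  under eq_bigr do rewrite -terrE.
  exact: le_trans (ler_norm _) N3.
have B4 : q * \sum_(1 <= k < n.+1) `|err k w| ^+ 2 <= eps * L2.
  apply: (@le_trans _ _ eps); last by rewrite ler_peMr // ltW.
  under eq_bigr do rewrite -tsqE.
  exact: le_trans (ler_norm _) N4.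
rewrite -(ler_pM2l lam_gt0); apply: le_trans (average_le _ _) _.
under eq_bigr do rewrite addrC subrK.
have G1 : `|\sum_(1 <= k < n.+1) Phi (Z k w)| <= 1 + (`|mart n w| +
    (c^-1 * (n%:R `^ alpha * `|err n w|) +
     c^-1 * \sum_(1 <= k < n.+1) k%:R `^ (alpha - 1) * `|err k w|)).
  (* The average includes k = n while [mart n] stops before it; the extra gradient has norm at most
     1. *)
  rewrite big_nat_recr //= addrC; apply: le_trans (ler_normD _ _) _.
  apply: lerD => //; have := gradient_sum_decomposition w n1.
  set g := \sum_(1 <= k < n) Phi _; set b := _ *: err n w => Hb.
  have -> : g = mart n w - (b + (mart n w - g - b)).
    by rewrite [b + _]addrC subrK opprB addrC subrK.
  apply: le_trans (ler_normB _ _) _; rewrite lerD2l.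
  apply: le_trans (ler_normD _ _) _; apply: lerD => //.
  by rewrite normrZ ger0_norm ?mulr_ge0 ?powR_ge0 ?(ltW ic0) // mulrA.
rewrite -qq -mulrA.
have -> : lam * (e * (L2 * q)) = q * (D * (eps * L2)).
  by rewrite /eps; field; rewrite gt_eqF.
rewrite ler_wpM2l ?(ltW q0) //.
apply: (@le_trans _ _ (q * (1 + (`|mart n w| +
    (c^-1 * (n%:R `^ alpha * `|err n w|) +
     c^-1 * \sum_(1 <= k < n.+1) k%:R `^ (alpha - 1) * `|err k w|)) +
     K * \sum_(1 <= k < n.+1) `|err k w| ^+ 2))).
  by rewrite ler_wpM2l ?(ltW q0) // lerD2r.
have B2' := ler_wpM2l (ltW ic0) B2; have B3' := ler_wpM2l (ltW ic0) B3.
have B4' := ler_wpM2l (ltW K_gt0) B4.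
rewrite /D; move: B0 B1 B2' B3' B4'.
move: (eps * L2) (`|mart n w|) (n%:R `^ alpha * _) (\sum_(_ <= _ < _) _ * _).
move: (\sum_(_ <= _ < _) _) c^-1 => s4 ic E s1 s2 s3.
by lra.
Unshelve. all: by end_near.
Qed.

Lemma average_err_ae_rate : {ae P, forall w, forall e : R, 0 < e ->
  \forall n \near \oo, `|n%:R^-1 *: \sum_(1 <= k < n.+1) err k w| <=
    e * (logw n `^ 2^-1 * n%:R `^ (- 2^-1))}.
Proof.
have A1 := err_ae_bounded; have A2 := mart_ae_rate.
(* Integer truncation levels leave countably many null sets, and the random bound of a path can be
   rounded up to one of them. *)
have A3 : {ae P, forall w, forall i : nat,
   n%:R `^ (2 * alpha - 1) / logw n * tsqerr i%:R n w @[n --> \oo] --> 0}.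
  by apply/ae_foralln => i; exact: tsqerr_ae_rate.
have A4 : {ae P, forall w, forall i : nat,
   n%:R `^ (- 2^-1) * \sum_(1 <= k < n.+1) k%:R `^ (alpha - 1) * terr i%:R k w
    @[n --> \oo] --> 0}.
  by apply/ae_foralln => i; exact: terr_sum_ae_cvg0.
have A5 : {ae P, forall w, forall i : nat,
   n%:R `^ (- 2^-1) * \sum_(1 <= k < n.+1) tsqerr i%:R k w @[n --> \oo] --> 0}.
  by apply/ae_foralln => i; exact: tsqerr_sum_ae_cvg0.
near=> w.
have [B HB] : exists M, forall n, (1 <= n)%N -> `|err n w| <= M by near: w.
have w2 : (n%:R * logw n)^-1 * `|mart n w| ^+ 2 @[n --> \oo] --> 0 by near: w.
pose i := (Num.truncn B).+1.
apply: (@average_err_rate w i%:R) => //.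
- by move=> n n1; apply: le_trans (HB n n1) _; rewrite ltW // truncnS_gt.
- by move: (i); near: w.
- by move: (i); near: w.
- by move: (i); near: w.
Unshelve. all: by end_near.
Qed.

End stochastic_gradient_increments.

Lemma average_sub (R : realType) (H : normedModType R) (T : Type)
    (Z : nat -> T -> H) (m : H) n w : (1 <= n)%N ->
  average Z n w - m = n%:R^-1 *: \sum_(1 <= k < n.+1) (Z k w - m).
Proof.
move=> n1; rewrite sumrB scalerBr /average; congr (_ - _).
rewrite sumr_const_nat subn1 /= -[m *+ _]scaler_nat scalerA mulVf ?scale1r //.
by rewrite pnatr_eq0 -lt0n.
Qed.

Theorem corollary5p1 (R : realType) (H : completeNormedModType R)
  (dot : {dot H for idfun}) (dot_norm : induces_norm dot)
  (H_separable : separable H)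
  (d : measure_display) (T : measurableType d) (P : probability T R)
  (X : {RV P >-> borel H})
  (A1 : assumption_A1 P dot X) (A2 : assumption_A2 P X)
  (m : H) (m_median : geometric_median P X m)
  (alpha c : R) (alpha_gt : 1 / 2 < alpha) (alpha_lt : alpha < 1) (c_gt0 : 0 < c)
  (Xs : nat -> {RV P >-> borel H})
  (Xs_law : forall n, (1 <= n)%N -> same_law (Xs n) X)
  (Xs_indep : mutually_independent [set n | (1 <= n)%N] Xs)
  (Z : nat -> T -> H)
  (Z1_measurable : forall A : set (borel H), measurable A ->
     g_sigma_algebra_preimage (Xs 1%N) (Z 1%N @^-1` A))
  (Z1_bounded : exists M : R, forall w, `|Z 1%N w| <= M)
  (Z_sgd : stochastic_gradient c alpha Xs Z) :
  forall delta : R, 0 < delta ->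
    {ae P, forall w,
      (fun n : nat => `|average Z n w - m|) =o_\oo
      (fun n : nat => (ln n%:R) `^ ((1 + delta) / 2) / Num.sqrt n%:R)}.
Proof.
move=> delta delta_gt0.
have [Phi [lam [K [[lam_gt0 K_gt0] PhiE [Phi_cont Phi_le1] Phi_mono Phi_avg]]]] :=
  median_gradient dot_norm H_separable A1 A2 m_median.
have := average_err_ae_rate dot_norm H_separable c_gt0 Xs_law Xs_indep
  Z1_measurable Z1_bounded Z_sgd PhiE Phi_cont Phi_le1 alpha_gt alpha_lt
  lam_gt0 Phi_mono delta_gt0 K_gt0 Phi_avg.
apply: filterS => w rate; apply/eqoP => e e0.
have := rate e e0; apply: filter_app; exists 1%N => // n /= n1 H1.
rewrite normr_id average_sub // (le_trans H1) // ler_wpM2l ?(ltW e0) //.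
by rewrite (le_trans _ (ler_norm _)) // -powRrM powRN powR12_sqrt.
Qed.
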